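(* Suppose that the following two assumptions hold. (Persistent connectivity) The directed graph $(\mathcal{N},\tilde{\mathcal{E}})$ with $\tilde{\mathcal{E}}=\{(j,i)\in\mathcal{N}\times\mathcal{N} \mid \int_0^{+\infty}a_{ij}(s)\,ds=+\infty\}$ is strongly connected. (Slow divergence of reciprocal interaction weights) For all $t\ge 0$, $\mathbf{r}(t)$ is finite, and $\sum_{p\in\mathbb{N}}\mathbf{r}(t_p)^{-\lfloor n/2\rfloor}=+\infty$. Then, for any initial positions, the trajectory $x$ of the system $\dot x_i(t)=\sum_{j=1}^n a_{ij}(t)(x_j(t)-x_i(t))$, $i\in\mathcal{N}$, reaches a consensus, i.e. the limits $\lim_{t\to+\infty}x_i(t)$ exist for all $i\in\mathcal{N}$ and are all equal.
   Context: Let $n\ge 2$ and $\mathcal{N}=\{1,\dots,n\}$. For $i,j\in\mathcal{N}$, let $a_{ij}:\mathbb{R}^+\to[0,+\infty)$ be measurable and integrable on bounded intervals of $\mathbb{R}^+=[0,+\infty)$. The system $\dot x_i(t)=\sum_{j=1}^n a_{ij}(t)(x_j(t)-x_i(t))$, $i\in\mathcal{N}$, is understood in the Carathéodory sense: a trajectory is a locally absolutely continuous $x:\mathbb{R}^+\to\mathbb{R}^n$ with $x_i(t)=x_i(0)+\int_0^t\sum_{j=1}^n a_{ij}(s)(x_j(s)-x_i(s))\,ds$ for all $t\ge 0$, $i\in\mathcal{N}$. Reciprocity ratio: for a non-empty proper subset $S\subsetneq\mathcal{N}$, let $r_S(t)=\frac{\sum_{i\in S,j\notin S}a_{ij}(t)}{\sum_{i\in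 S,j\notin S}a_{ji}(t)}$ if the denominator is positive, $r_S(t)=1$ if numerator and denominator are both zero, and $r_S(t)=+\infty$ if the denominator is zero and the numerator is positive. Let $r(t)=\max_{\emptyset\ne S\subsetneq\mathcal{N}}r_S(t)$ and $\mathbf{r}(t)=\sup_{s\in[0,t]}r(s)\in[1,+\infty]$. A directed graph on $\mathcal{N}$ is strongly connected if there is a directed path from $i$ to $j$ for all distinct $i,j\in\mathcal{N}$. Time sequence (well defined under persistent connectivity): $t_0=0$; for $p\in\mathbb{N}=\{0,1,2,\dots\}$, set $t_p^0=t_p$ and, for $q\in\{0,\dots,\lfloor n/2\rfloor-1\}$, let $t_p^{q+1}$ be the smallest $t\ge t_p^q$ such that $\min_{\emptyset\ne S\subsetneq\mathcal{N}}\Big(\sum_{i\in S}\sum_{j\in\mathcal{N}\setminus S}\int_{t_p^q}^{t}a_{ij}(s)\,ds\Big)=1$; finally $t_{p+1}=t_p^{\lfloor n/2\rfloor}$. *)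

(* Defs.v *)
From HB Require Import structures.
From mathcomp Require Import all_boot all_order all_algebra.
From mathcomp Require Import all_classical all_reals all_analysis.

Set Implicit Arguments.
Unset Strict Implicit.
Unset Printing Implicit Defensive.

Import Order.TTheory GRing.Theory Num.Theory.
Import numFieldNormedType.Exports.

Local Open Scope classical_set_scope.
Local Open Scope ring_scope.

(* R with the sigma-algebra of Lebesgue measurable sets, the domain of
   completed_lebesgue_measure; lebesgue_measure itself only knows Borel sets. *)
Notation lebesgue_type R :=
  (caratheodory_type (@wlength R idfun)^*%mu).

(* Functions on the half-line [0, +oo[ are represented by functions on R; every
   condition below only involves their values at nonnegative times. *)

Definition admissible_weights (R : realType) (n : nat)
    (a : 'I_n -> 'I_n -> R -> R) : Prop :=
  forall i j : 'I_n,
    [/\ forall t, 0 <= t -> 0 <= a i j t,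
        measurable_fun (`[0, +oo[ : set (lebesgue_type R)) (a i j)
      & forall T, 0 <= T ->
          (@completed_lebesgue_measure R).-integrable `[0, T] (EFin \o a i j)].

(* u k = v k is allowed: a degenerate interval contributes nothing. *)
Definition absolutely_continuous_on (R : realType) (A B : R) (f : R -> R)
    : Prop :=
  forall e : R, 0 < e -> exists2 d : R, 0 < d &
    forall (m : nat) (u v : 'I_m -> R),
      (forall k, [/\ A <= u k, u k <= v k & v k <= B]) ->
      trivIset [set: 'I_m] (fun k => `]u k, v k[%classic) ->
      \sum_(k < m) (v k - u k) < d ->
      \sum_(k < m) `|f (v k) - f (u k)| < e.

(* The integrand is integrable on [0, t]: x is continuous there and the weights
   are integrable. *)
Definition trajectory (R : realType) (n : nat) (a : 'I_n -> 'I_n -> R -> R)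
    (x : 'I_n -> R -> R) : Prop :=
  (forall (i : 'I_n) (T : R), 0 <= T -> absolutely_continuous_on 0 T (x i)) /\
  (forall (i : 'I_n) (t : R), 0 <= t ->
     x i t = x i 0 + \int[@completed_lebesgue_measure R]_(s in `[0, t])
                       \sum_(j < n) a i j s * (x j s - x i s)).

Definition nonempty_proper (n : nat) (S : {set 'I_n}) : bool :=
  (S != finset.set0) && (S \proper finset.setT).

(* At nonnegative times the weights are nonnegative, so den <= 0 means den = 0. *)
Definition cut_ratio (R : realType) (n : nat) (a : 'I_n -> 'I_n -> R -> R)
    (S : {set 'I_n}) (t : R) : \bar R :=
  let num := \sum_(i in S) \sum_(j in ~: S) a i j t in
  let den := \sum_(i in S) \sum_(j in ~: S) a j i t in
  if 0 < den then (num / den)%:E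
  else if num == 0 then 1%E else +oo%E.

Definition reciprocity_ratio (R : realType) (n : nat)
    (a : 'I_n -> 'I_n -> R -> R) (t : R) : \bar R :=
  \big[maxe/-oo%E]_(S : {set 'I_n} | nonempty_proper S) cut_ratio a S t.

Definition sup_reciprocity_ratio (R : realType) (n : nat)
    (a : 'I_n -> 'I_n -> R -> R) (t : R) : \bar R :=
  ereal_sup [set reciprocity_ratio a s | s in `[0, t]].

(* An edge from j to i means that i is influenced by j. *)
Definition persistent_edge (R : realType) (n : nat)
    (a : 'I_n -> 'I_n -> R -> R) : rel 'I_n :=
  fun j i => (\int[@completed_lebesgue_measure R]_(s in `[0%R, +oo[) (a i j s)%:E
              == +oo)%E.

Definition strongly_connected (n : nat) (e : rel 'I_n) : Prop :=
  forall i j : 'I_n, i != j -> connect e i j.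

Definition persistent_connectivity (R : realType) (n : nat)
    (a : 'I_n -> 'I_n -> R -> R) : Prop :=
  strongly_connected (persistent_edge a).

Definition min_cut_weight (R : realType) (n : nat)
    (a : 'I_n -> 'I_n -> R -> R) (u t : R) : \bar R :=
  \big[mine/+oo%E]_(S : {set 'I_n} | nonempty_proper S)
    (\sum_(i in S) \sum_(j in ~: S)
       \int[@completed_lebesgue_measure R]_(s in `[u, t]) (a i j s)%:E)%E.

(* The least element of E; the junk value 0 if there is none. *)
Definition least (R : realType) (E : set R) : R := xget 0 (E `&` lbound E).

Definition next_time (R : realType) (n : nat) (a : 'I_n -> 'I_n -> R -> R)
    (u : R) : R :=
  least [set t | u <= t /\ min_cut_weight a u t = 1%E].

Fixpoint time_seq (R : realType) (n : nat) (a : 'I_n -> 'I_n -> R -> R)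
    (p : nat) : R :=
  if p is p'.+1 then iter n./2 (next_time a) (time_seq a p') else 0.

Definition slow_divergence (R : realType) (n : nat)
    (a : 'I_n -> 'I_n -> R -> R) : Prop :=
  (forall t, 0 <= t -> sup_reciprocity_ratio a t \is a fin_num) /\
  (\sum_(0 <= p <oo)
     (fine (sup_reciprocity_ratio a (time_seq a p)) ^- n./2)%:E = +oo)%E.

Definition reaches_consensus (R : realType) (n : nat) (x : 'I_n -> R -> R)
    : Prop :=
  (forall i : 'I_n, cvg (x i t @[t --> +oo])) /\
  (forall i j : 'I_n, lim (x i t @[t --> +oo]) = lim (x j t @[t --> +oo])).

(* Main.v *)
Require Import Defs.
From mathcomp Require Import all_boot all_order all_algebra all_fingroup.
From mathcomp Require Import all_classical all_reals all_analysis.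
From mathcomp Require Import measurable_realfun ring lra zify.

(* Write n for the number of agents, h = n/2 rounded down, and let K bound all
   reciprocity ratios up to time t_(p+1). Sorting the positions decreasingly,
   z_1 >= z_2 >= ..., each truncated potential
   V_g = z_1 + z_2/K + ... + z_g/K^(g-1) is nonincreasing: Abel summation writes
   its drift as a sum over the cuts {1, ..., l}, on which the weights K^-l
   compensate the reciprocity ratio.

   Of the agents above and those below the middle of the range at t_p, one
   group, say the upper one, has at most h members. Let M bound all positions
   and suppose that exactly g >= 1 agents lie above M - d. During an interval on
   which every cut has integrated weight at least 1, V_g falls below
   M (1 + ... + K^(1-g)) by a multiple of d K^-g: as long as the other agents
   stay below M - d/2 the weight entering the group pulls V_g down, and for one
   of them to reach M - d/2 the weight leaving the group must be at least 1/2,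
   so the weight entering it is at least 1/(2K). Hence for some l >= 1 at most
   g - l agents lie above M - d (q/K)^l, with q = 1/(16 n). After h intervals no
   agent is left above M - d (q/K)^h, so the diameter shrinks by the factor
   1 - (q/K)^h / 2 between t_p and t_(p+1), and divergence of the series sends
   it to 0.

   No almost everywhere differentiation is needed: over a short interval,
   freezing the positions at the right end costs an error quadratic in the
   integrated weight, and such errors vanish under subdivision. *)

Set Implicit Arguments.
Unset Strict Implicit.
Unset Printing Implicit Defensive.

Import Order.TTheory GRing.Theory Num.Theory.
Import numFieldNormedType.Exports.

Local Open Scope classical_set_scope.
Local Open Scope ring_scope.

(* The quadratic error disappears under bisection of the A-length. *)
Lemma nonincreasing_of_quadratic (R : realType) (F A : R -> R) (C s t : R) :
  s <= t -> continuous A ->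
  (forall u v, s <= u -> u <= v -> v <= t ->
     F v - F u <= C * (A v - A u) ^+ 2) -> F t <= F s.
Proof.
move=> st cA FA.
have bisect k u v : s <= u -> u <= v -> v <= t ->
    F v - F u <= C * (A v - A u) ^+ 2 / 2 ^+ k.
  elim: k u v => [|k IH] u v su uv vt; first by rewrite expr0 divr1; exact: FA.
  (* The midpoint is taken in the values of [A], by the intermediate value theorem. Two squares of
     halves sum to half the square, so each bisection gains a factor 2. *)
  have [w /andP[uw wv] Aw] : exists2 w, u <= w <= v & A w = (A u + A v) / 2.
    have [|w] := @IVT R A u v ((A u + A v) / 2) uv (continuous_subspaceT cA) _.
    - by rewrite minElt maxElt; case: ifPn; lra.
    - by rewrite in_itv => ? ?; exists w.
  have := IH u w su uw (le_trans wv vt).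
  have := IH w v (le_trans su uw) wv vt.
  rewrite Aw (exprS _ k); set X := 2 ^+ k.
  have X0 : 0 < X by exact: exprn_gt0.
  set Y := C * (A v - A u) ^+ 2 / (2 * X).
  have -> : C * (A v - (A u + A v) / 2) ^+ 2 / X = Y / 2.
    by rewrite /Y; field; rewrite lt0r_neq0.
  have -> : C * ((A u + A v) / 2 - A u) ^+ 2 / X = Y / 2.
    by rewrite /Y; field; rewrite lt0r_neq0.
  by move: Y => Y; lra.
rewrite leNgt -subr_gt0; apply/negP => FsFt.
set D := C * (A t - A s) ^+ 2 in bisect *.
have : (fun k => D / 2 ^+ k) @ \oo --> (0 : R).
  have -> : (fun k => D / 2 ^+ k) = geometric D 2^-1.
    by apply/funext => k; rewrite /geometric/= exprVn.
  by apply: cvg_geometric; rewrite ger0_norm; lra.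
move=> /cvgrPdist_lt/(_ _ FsFt)[k _ /(_ k (leqnn k))] /=; rewrite sub0r normrN.
move=> /(le_lt_trans (ler_norm _)); apply/negP; rewrite -leNgt.
exact: bisect.
Qed.

(** The hitting time is the infimum of the closed set of times in [[u, v]] with [c <= f]. A value
    above [c] there would give, by the intermediate value theorem, an earlier time with value
    [c]. *)
Lemma first_hitting (R : realType) (f : R -> R) (u v c : R) :
  u <= v -> continuous f -> f u <= c -> c <= f v ->
  exists2 t, u <= t <= v & f t = c /\ (forall r, u <= r -> r < t -> f r < c).
Proof.
move=> uv cf fuc cfv.
pose E := [set t | u <= t <= v] `&` (f @^-1` [set y | c <= y]).
have Ev : E v by split => //=; rewrite uv lexx.
have lbE : lbound E u by move=> t [/= /andP[]].
have clE : closed E.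
  apply: closedI.
    rewrite (_ : [set t | _] = `[u, v]%classic); last first.
      by apply/seteqP; split => t /=; rewrite in_itv.
    exact: interval_closed.
  by apply: closed_comp; [move=> t _; exact: cf | exact: closed_ge].
have [/andP[uE Ev'] cE] : E (inf E).
  apply: itv_closed_infimums => //; first by exists v.
  split; first by apply: ge_inf; exists u.
  by move=> y lby; apply: lb_le_inf => //; exists v.
have below r : u <= r -> r < inf E -> f r < c.
  move=> ur rE; rewrite ltNge; apply/negP => cfr.
  have /(ge_inf (ex_intro _ u lbE)) : E r.
    by split => //=; rewrite ur (le_trans (ltW rE)).
  by rewrite leNgt rE.
exists (inf E); rewrite ?uE //; split => //.
apply/eqP; rewrite eq_le; apply/andP; split; last exact: cE.
have [w /andP[uw wE] fw] : exists2 w, u <= w <= inf E & f w = c.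
  have [|w] := @IVT R f u (inf E) c uE (continuous_subspaceT cf) _.
  - by move: cE => /= cE; rewrite ge_min fuc le_max cE orbT.
  - by rewrite in_itv => ? ?; exists w.
move: wE; rewrite (le_eqVlt w) => /orP[/eqP <-|/(below w uw)]; first by rewrite fw.
by rewrite fw ltxx.
Qed.

(** * The drift of the truncated potentials *)

(** Difference of two telescoping sums that start at [ord0]. The indicators show which cuts
    [{0, ..., k}] separate [i] from [j], and with which sign. *)
Lemma sum_gaps (R : realType) (m : nat) (y : 'I_m.+1 -> R) (i j : 'I_m.+1) :
  y j - y i = \sum_(k < m) ((k < i)%:R - (k < j)%:R) *
                             (y (inord k) - y (inord k.+1)).
Proof.
have gaps (p : 'I_m.+1) : y ord0 - y p =
    \sum_(k < m) (k < p)%:R * (y (inord k) - y (inord k.+1)).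
  transitivity (\sum_(k < m | (k < p)%N) (y (inord k) - y (inord k.+1))).
    rewrite -(big_ord_widen _ (fun k => y (inord k) - y (inord k.+1))); last first.
      by rewrite -ltnS.
    rewrite -(big_mkord xpredT (fun k => y (inord k) - y (inord k.+1))).
    rewrite -[LHS]opprB -[in LHS](inord_val p) -[in LHS](inord_val ord0).
    rewrite -(telescope_sumr (fun k => y (inord k)) (leq0n p)).
    by rewrite -sumrN; apply: eq_bigr => k _; rewrite opprB.
  by rewrite big_mkcond; apply: eq_bigr => k _; case: ifP; rewrite ?mul1r ?mul0r.
rewrite (_ : y j - y i = (y ord0 - y i) - (y ord0 - y j)); last by lra.
by rewrite !gaps -sumrB; apply: eq_bigr => k _; rewrite mulrBl.
Qed.

(* Abel summation over the gaps of y reduces the drift to the cut {0, ..., k},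
   where balance bounds it by (K w_(k+1) - w_k) times the inflow. *)
Lemma weighted_drift_le (R : realType) (m : nat) (b : 'I_m.+1 -> 'I_m.+1 -> R)
    (y : 'I_m.+1 -> R) (w : nat -> R) (K : R) :
  1 <= K -> (forall i j, 0 <= b i j) ->
  (forall i j : 'I_m.+1, (i <= j)%N -> y j <= y i) ->
  (forall k, 0 <= w k) -> (forall k, K * w k.+1 <= w k) ->
  (forall k, (k < m)%N ->
     \sum_(i < m.+1 | (k < i)%N) \sum_(j < m.+1 | (j <= k)%N) b i j <=
     K * \sum_(i < m.+1 | (i <= k)%N) \sum_(j < m.+1 | (k < j)%N) b i j) ->
  \sum_(i < m.+1) w i * (\sum_j b i j * (y j - y i)) <=
  - \sum_(k < m) (y (inord k) - y (inord k.+1)) * ((w k - K * w k.+1) *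
      \sum_(i < m.+1 | (i <= k)%N) \sum_(j < m.+1 | (k < j)%N) b i j).
Proof.
move=> K1 b0 ymon w0 Kw bal.
have wmon p q : (p <= q)%N -> w q <= w p.
  elim: q => [|q IH]; first by rewrite leqn0 => /eqP ->.
  rewrite leq_eqVlt => /orP[/eqP -> //|pq].
  apply: le_trans (IH pq); apply: le_trans (Kw q).
  by rewrite ler_peMl.
have -> : \sum_(i < m.+1) w i * (\sum_j b i j * (y j - y i)) =
    \sum_(k < m) (y (inord k) - y (inord k.+1)) *
      \sum_(i < m.+1) \sum_(j < m.+1) w i * b i j * ((k < i)%:R - (k < j)%:R).
  under eq_bigr => i _ do rewrite big_distrr /=.
  under eq_bigr => i _ do under eq_bigr => j _ do rewrite sum_gaps big_distrr big_distrr /=.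
  under eq_bigr => i _ do rewrite exchange_big /=.
  rewrite exchange_big /=; apply: eq_bigr => k _.
  rewrite big_distrr; apply: eq_bigr => i _ /=.
  by rewrite big_distrr; apply: eq_bigr => j _ /=; ring.
rewrite -sumrN; apply: ler_sum => k _; rewrite -mulrN.
have km : (k < m.+1)%N by rewrite ltnW // ltnS.
apply: ler_wpM2l.
  by rewrite subr_ge0; apply: ymon; rewrite !inordK // ltnS.
have -> : \sum_(i < m.+1) \sum_(j < m.+1) w i * b i j * ((k < i)%:R - (k < j)%:R) =
    \sum_(i < m.+1 | (k < i)%N) \sum_(j < m.+1 | (j <= k)%N) w i * b i j -
    \sum_(i < m.+1 | (i <= k)%N) \sum_(j < m.+1 | (k < j)%N) w i * b i j.
  rewrite [in X in _ = X - _]big_mkcond [in X in _ = _ - X]big_mkcond /= -sumrB.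
  apply: eq_bigr => i _; case: (ltnP k i) => ki.
    rewrite subr0 [RHS]big_mkcond; apply: eq_bigr => j _; case: ltnP => kj.
      by rewrite subrr mulr0.
    by rewrite subr0 mulr1.
  rewrite sub0r [in RHS]big_mkcond -sumrN; apply: eq_bigr => j _; case: ltnP => kj.
    by rewrite sub0r mulrN1.
  by rewrite subr0 mulr0 oppr0.
set inn := \sum_(i < m.+1 | (i <= k)%N) \sum_(j < m.+1 | (k < j)%N) b i j.
set out := \sum_(i < m.+1 | (k < i)%N) \sum_(j < m.+1 | (j <= k)%N) b i j.
(* As [w] decreases, indices beyond [k] weigh at most [w k.+1] and the others at least [w k];
   balance then trades [out] for [K * inn]. *)
have h1 : \sum_(i < m.+1 | (k < i)%N) \sum_(j < m.+1 | (j <= k)%N) w i * b i j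
    <= w k.+1 * out.
  rewrite big_distrr /=; apply: ler_sum => i ki; rewrite big_distrr /=.
  by apply: ler_sum => j _ /=; apply: ler_wpM2r => //; exact: wmon.
have h2 : w k * inn <=
    \sum_(i < m.+1 | (i <= k)%N) \sum_(j < m.+1 | (k < j)%N) w i * b i j.
  rewrite big_distrr /=; apply: ler_sum => i ki; rewrite big_distrr /=.
  by apply: ler_sum => j _ /=; apply: ler_wpM2r => //; exact: wmon.
have h3 : w k.+1 * out <= w k.+1 * (K * inn).
  by apply: ler_wpM2l => //; exact: bal.
apply: (le_trans (lerB (le_trans h1 h3) h2)).
by rewrite mulrBl; lra.
Qed.

(** Here [g] counts the ranks kept. With ratio [1/K] the surplus [w k - K * w k.+1] vanishes except
    at the last rank kept. *)
Definition top_weight (R : realType) (K : R) (g k : nat) : R :=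
  if (k < g)%N then K^-1 ^+ k else 0.

Lemma top_weight_ge0 (R : realType) (K : R) (g k : nat) :
  1 <= K -> 0 <= top_weight K g k.
Proof.
move=> K1; rewrite /top_weight; case: ifP => // _.
by rewrite exprn_ge0 // invr_ge0; lra.
Qed.

Lemma top_weight_step (R : realType) (K : R) (g k : nat) :
  1 <= K -> K * top_weight K g k.+1 <= top_weight K g k.
Proof.
move=> K1; have K0 : K != 0 by rewrite gt_eqF //; lra.
have := top_weight_ge0 g k K1; rewrite /top_weight.
case: (ltnP k.+1 g) => [kg|_]; last by rewrite mulr0.
by rewrite (ltn_trans _ kg) // exprS mulrA mulfV // mul1r.
Qed.

(** Every gap term is nonnegative and only the one at rank [g] is retained: the next weight is 0
    there, so the surplus is all of [K^-1 ^+ g]. *)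
Lemma top_drift_le (R : realType) (m : nat) (b : 'I_m.+1 -> 'I_m.+1 -> R)
    (y : 'I_m.+1 -> R) (K e : R) (g : nat) :
  1 <= K -> (forall i j, 0 <= b i j) ->
  (forall i j : 'I_m.+1, (i <= j)%N -> y j <= y i) ->
  (forall k, (k < m)%N ->
     \sum_(i < m.+1 | (k < i)%N) \sum_(j < m.+1 | (j <= k)%N) b i j <=
     K * \sum_(i < m.+1 | (i <= k)%N) \sum_(j < m.+1 | (k < j)%N) b i j) ->
  (forall i j : 'I_m.+1, (i <= g)%N -> (g < j)%N -> e <= y i - y j) ->
  \sum_(i < m.+1) top_weight K g.+1 i * (\sum_j b i j * (y j - y i)) <=
  - (K^-1 ^+ g * e *
     \sum_(i < m.+1 | (i <= g)%N) \sum_(j < m.+1 | (g < j)%N) b i j).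
Proof.
move=> K1 b0 ymon bal gap.
apply: (le_trans (weighted_drift_le K1 b0 ymon
  (fun k => top_weight_ge0 g.+1 k K1) (fun k => top_weight_step g.+1 k K1) bal)).
have term_ge0 (k : 'I_m) : 0 <= (y (inord k) - y (inord k.+1)) *
   ((top_weight K g.+1 k - K * top_weight K g.+1 k.+1) *
    \sum_(i < m.+1 | (i <= k)%N) \sum_(j < m.+1 | (k < j)%N) b i j).
  apply: mulr_ge0.
    by rewrite subr_ge0; apply: ymon; rewrite !inordK ?ltnS // ltnW.
  apply: mulr_ge0; first by rewrite subr_ge0 top_weight_step.
  by apply: sumr_ge0 => i _; apply: sumr_ge0.
rewrite lerN2; case: (ltnP g m) => gm; last first.
  rewrite big1 ?mulr0 ?sumr_ge0 // => i _.
  by rewrite big1 // => j gj; move: (ltn_ord j); rewrite ltnS leqNgt (leq_ltn_trans gm gj).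
rewrite (bigD1 (Ordinal gm)) //= -[leLHS]addr0 lerD ?sumr_ge0 //.
rewrite /top_weight ltnS leqnn ltnn mulr0 subr0 mulrCA mulrA.
apply: ler_wpM2r; first by apply: sumr_ge0 => i _; apply: sumr_ge0.
apply: ler_wpM2l; first by rewrite exprn_ge0 // invr_ge0; lra.
by apply: gap; rewrite !inordK ?ltnS // ltnW.
Qed.

(** * Contraction of the diameter *)

(** The exchange step of the rearrangement inequality. *)
Lemma sum_swap (R : realType) (n : nat) (w z : 'I_n -> R) (s : 'S_n) (i j : 'I_n) :
  i != j ->
  \sum_k w k * z ((tperm i j * s)%g k) =
  \sum_k w k * z (s k) + (w i - w j) * (z (s j) - z (s i)).
Proof.
move=> ij; rewrite (bigD1 i) //= (bigD1 j) 1?eq_sym //=.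
rewrite [in RHS](bigD1 i) //= [in RHS](bigD1 j) 1?eq_sym //=.
rewrite !permM tpermL tpermR.
under eq_bigr => k /andP[ki kj] do rewrite permM tpermD 1?eq_sym //.
by ring.
Qed.

(* Among the maximisers of w, one that also maximises strictly decreasing
   weights is sorted: an inversion could be swapped. *)
Lemma sorted_maximizer (R : realType) (n : nat) (w z : 'I_n -> R) :
  (forall i j : 'I_n, (i <= j)%N -> w j <= w i) ->
  exists s : 'S_n, (forall i j : 'I_n, (i <= j)%N -> z (s j) <= z (s i)) /\
    forall s' : 'S_n, \sum_k w k * z (s' k) <= \sum_k w k * z (s k).
Proof.
move=> wmon.
pose f (w : 'I_n -> R) (s : 'S_n) := \sum_k w k * z (s k).
have [s1 _ s1max] := @arg_maxP _ _ _ (1%g : 'S_n) xpredT (f w) isT.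
pose w' (i : 'I_n) : R := (n - i)%:R.
have [s ss1 smax] := @arg_maxP _ _ _ s1 [pred s | f w s1 <= f w s] (f w') (lexx _).
exists s; split; last by move=> s'; apply: le_trans ss1; exact: s1max.
move=> i j; rewrite leq_eqVlt => /orP[/eqP/val_inj -> //|ij].
rewrite leNgt; apply/negP => zij.
have nij : i != j by rewrite neq_ltn ij.
have /smax : f w s1 <= f w (tperm i j * s)%g.
  apply: (le_trans ss1); rewrite /f sum_swap // lerDl mulr_ge0 //.
    by rewrite subr_ge0 wmon // ltnW.
  by rewrite subr_ge0 ltW.
rewrite /f /= sum_swap // gerDl leNgt => /negP; apply.
by rewrite mulr_gt0 // subr_gt0 // ltr_nat ltn_sub2l.
Qed.

(** Reindexing both sums by [s] turns a cut of agents into a cut of ranks, the form in which the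
    drift is estimated. *)
Lemma sum_perm_cut (R : realType) (n : nat) (s : 'S_n) (k : nat)
    (F : 'I_n -> 'I_n -> R) (S := [set s i | i : 'I_n & (i <= k)%N]%SET) :
  \sum_(i in S) \sum_(j in ~: S) F i j =
  \sum_(i < n | (i <= k)%N) \sum_(j < n | (k < j)%N) F (s i) (s j).
Proof.
have inS i : (s i \in S) = (i <= k)%N.
  by rewrite /S (mem_imset _ _ perm_inj) inE.
rewrite (reindex_inj (@perm_inj _ s)) /=; apply: eq_big => [i|i _]; first exact: inS.
rewrite (reindex_inj (@perm_inj _ s)) /=; apply: eq_big => // j.
by rewrite finset.in_setC inS -ltnNge.
Qed.

Lemma bigmax_attained (R : realType) (I : finType) (P : pred I) (c : R) (F : I -> R) :
  \big[Num.max/c]_(i | P i) F i = c \/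
  exists2 i, P i & \big[Num.max/c]_(i | P i) F i = F i.
Proof.
apply: (big_ind (fun y => y = c \/ exists2 i, P i & y = F i)).
- by left.
- by move=> y z; rewrite maxElt; case: ifP.
- by move=> i Pi; right; exists i.
Qed.

Lemma continuous_bigmax (R : realType) (I : finType) (P : pred I) (c : R)
    (F : I -> R -> R) :
  (forall i, continuous (F i)) ->
  continuous (fun t => \big[Num.max/c]_(i | P i) F i t).
Proof. by move=> cF; apply: continuous_big => [|i _]; [exact: max_continuous|]. Qed.

(** * Flows and the evolution of sorted positions *)

Section flow.
Variables (R : realType) (m : nat).
Local Notation I := 'I_m.+1.
Implicit Types (A : I -> I -> R -> R) (x : I -> R -> R) (S : {set I}).

Definition total_weight A t : R := \sum_i \sum_j A i j t.

Definition inflow A S u v : R :=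
  \sum_(i in S) \sum_(j in ~: S) (A i j v - A i j u).

Definition outflow A S u v : R :=
  \sum_(i in S) \sum_(j in ~: S) (A j i v - A j i u).

(* The equations enter only through integrated weights A and the fact that
   freezing the positions on [u, v] costs a quadratic error. *)
Record flow A x (K T : R) : Prop := Flow {
  flow_weight_cont : forall i j, continuous (A i j);
  flow_mono : forall i j u v, u <= v -> A i j u <= A i j v;
  flow_cont : forall i, continuous (x i);
  flow_frozen : exists2 C, 0 <= C & forall i u v, 0 <= u -> u <= v -> v <= T ->
    `|x i v - x i u - \sum_j (A i j v - A i j u) * (x j v - x i v)| <=
    C * (total_weight A v - total_weight A u) ^+ 2;
  flow_ratio : 1 <= K;
  flow_balanced : forall S u v, nonempty_proper S -> 0 <= u -> u <= v -> v <= T ->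
    outflow A S u v <= K * inflow A S u v }.

Lemma continuous_total_weight A : (forall i j, continuous (A i j)) ->
  continuous (total_weight A).
Proof.
move=> cA; apply: continuous_big => [|i _]; first exact: add_continuous.
by apply: continuous_big => [|j _]; first exact: add_continuous.
Qed.

Lemma sorted_maximizer_top (K : R) (g : nat) (z : I -> R) : 1 <= K ->
  exists s : 'S_m.+1, (forall i j : I, (i <= j)%N -> z (s j) <= z (s i)) /\
    forall s' : 'S_m.+1, \sum_(k < m.+1) top_weight K g k * z (s' k) <=
                   \sum_(k < m.+1) top_weight K g k * z (s k).
Proof.
move=> K1; apply: sorted_maximizer => i j.
elim: (j : nat) => [|q IH]; first by rewrite leqn0 => /eqP ->.
rewrite leq_eqVlt => /orP[/eqP -> //|pq].
apply: le_trans (IH pq); apply: le_trans (top_weight_step g q K1).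
by rewrite ler_peMl // top_weight_ge0.
Qed.

Section fixed_flow.
Variables (A : I -> I -> R -> R) (x : I -> R -> R) (K T : R).
Hypothesis Ax : flow A x K T.

Let K1 : 1 <= K := flow_ratio Ax.

(** The maximality that comes with sortedness lets the order found at one time be used as a lower
    bound for the potential at another, so crossings of agents need no separate treatment. *)
Definition sorting (g : nat) (t : R) : 'S_m.+1 :=
  projT1 (cid (sorted_maximizer_top g (x^~ t) (flow_ratio Ax))).

Lemma sorting_antitone g t (i j : I) : (i <= j)%N ->
  x (sorting g t j) t <= x (sorting g t i) t.
Proof. by rewrite /sorting; case: cid => s /= [+ _]; apply. Qed.

Definition top_potential (g : nat) (t : R) : R :=
  \sum_(k < m.+1) top_weight K g k * x (sorting g t k) t.

Lemma top_potential_ge g t (s : 'S_m.+1) :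
  \sum_(k < m.+1) top_weight K g k * x (s k) t <= top_potential g t.
Proof. by rewrite /top_potential /sorting; case: cid => s' /= [_]; apply. Qed.

(** The index [g] is the last rank included, hence the [g.+1] in [sorting], which matches
    [top_potential g.+1]. *)
Definition top_set (g : nat) (t : R) : {set I} :=
  [set sorting g.+1 t i | i : I & (i <= g)%N]%SET.

Lemma balanced_top (s : 'S_m.+1) (u v : R) (k : nat) :
  0 <= u -> u <= v -> v <= T -> (k < m)%N ->
  \sum_(i < m.+1 | (k < i)%N) \sum_(j < m.+1 | (j <= k)%N)
     (A (s i) (s j) v - A (s i) (s j) u) <=
  K * \sum_(i < m.+1 | (i <= k)%N) \sum_(j < m.+1 | (k < j)%N)
     (A (s i) (s j) v - A (s i) (s j) u).
Proof.
move=> u0 uv vT km.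
pose S := [set s i | i : I & (i <= k)%N]%SET.
have SP : nonempty_proper S.
  rewrite /nonempty_proper; apply/andP; split.
    apply/finset.set0Pn; exists (s ord0).
    by rewrite /S (mem_imset _ _ perm_inj) inE.
  rewrite finset.properT; apply/eqP => /setP /(_ (s ord_max)).
  by rewrite /S (mem_imset _ _ perm_inj) !inE /= leqNgt km.
have := flow_balanced Ax SP u0 uv vT.
rewrite /outflow /inflow /S !sum_perm_cut.
by rewrite exchange_big.
Qed.

(** The order at [v] is used at both ends: by maximality this can only enlarge the increment, which
    becomes that of a fixed linear combination. Each of the [m.+1] agents adds one freezing error,
    with weight at most 1. *)
Lemma top_potential_drift : exists2 C, 0 <= C & forall g u v e,
  0 <= u -> u <= v -> v <= T ->
  (forall i j, i \in top_set g v -> j \notin top_set g v -> e <= x i v - x j v) ->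
  top_potential g.+1 v - top_potential g.+1 u <=
    (C *+ m.+1) * (total_weight A v - total_weight A u) ^+ 2
    - K^-1 ^+ g * e * inflow A (top_set g v) u v.
Proof.
have [C C0 HC] := flow_frozen Ax.
exists C => // g u v e u0 uv vT gap.
set s := sorting g.+1 v; set D := (_ - _) ^+ 2.
have D0 : 0 <= D by exact: sqr_ge0.
have w1 (k : nat) : top_weight K g.+1 k <= 1.
  rewrite /top_weight; case: ifP => // _.
  by rewrite exprn_ile1 ?invr_ge0 ?invf_le1; have := K1; lra.
have ins i : (s i \in top_set g v) = (i <= g)%N.
  by rewrite /top_set (mem_imset _ _ perm_inj) inE.
apply: (le_trans (lerB (lexx _) (top_potential_ge g.+1 u s))).
rewrite /top_potential -/s -sumrB.
apply: (@le_trans _ _ (\sum_(k < m.+1) (C * D + top_weight K g.+1 k *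
    \sum_j (A (s k) (s j) v - A (s k) (s j) u) * (x (s j) v - x (s k) v)))).
  apply: ler_sum => k _; rewrite -mulrBr.
  have := HC (s k) u v u0 uv vT; rewrite ler_norml => /andP[_].
  rewrite (reindex_inj (@perm_inj _ s)) /= -/D lerBlDr => h.
  apply: (le_trans (ler_wpM2l (top_weight_ge0 g.+1 k K1) h)).
  by rewrite mulrDr lerD2r; apply: ler_piMl (w1 _); exact: mulr_ge0 C0 D0.
rewrite big_split /= sumr_const card_ord mulrnAl lerD2l.
rewrite /inflow sum_perm_cut.
apply: (@top_drift_le _ _ (fun i j => A (s i) (s j) v - A (s i) (s j) u)
  (fun i => x (s i) v)) => //.
- by move=> i j; rewrite subr_ge0; exact: (flow_mono Ax).
- by move=> i j; exact: sorting_antitone.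
- by move=> k km; exact: balanced_top.
- by move=> i j ig gj; apply: gap; rewrite ins // -ltnNge.
Qed.

Lemma inflow_sub S a u v : inflow A S a v - inflow A S a u = inflow A S u v.
Proof.
rewrite /inflow -sumrB; apply: eq_bigr => i _; rewrite -sumrB.
by apply: eq_bigr => j _; ring.
Qed.

Lemma outflow_sub S a u v : outflow A S a v - outflow A S a u = outflow A S u v.
Proof.
rewrite /outflow -sumrB; apply: eq_bigr => i _; rewrite -sumrB.
by apply: eq_bigr => j _; ring.
Qed.

(** Adding the accumulated inflow term back to the potential leaves only the quadratic error in each
    increment, and [nonincreasing_of_quadratic] removes it. *)
Lemma top_potential_drop g u v e S : 0 <= u -> u <= v -> v <= T ->
  (forall t, u <= t -> t <= v -> top_set g t = S /\
     forall i j, i \in S -> j \notin S -> e <= x i t - x j t) ->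
  top_potential g.+1 v <=
    top_potential g.+1 u - K^-1 ^+ g * e * inflow A S u v.
Proof.
move=> u0 uv vT topS; have [C C0 HC] := top_potential_drift.
pose F t := top_potential g.+1 t + K^-1 ^+ g * e * inflow A S u t.
suff : F v <= F u.
  rewrite /F (_ : inflow A S u u = 0) ?mulr0 ?addr0 1?lerBrDr //.
  by rewrite -(inflow_sub S u) subrr.
apply: (nonincreasing_of_quadratic uv
  (continuous_total_weight (flow_weight_cont Ax)) (C := C *+ m.+1)).
move=> a b ua ab bv; have [tS gap] := topS b (le_trans ua ab) bv.
have := HC g a b e (le_trans u0 ua) ab (le_trans bv vT).
rewrite tS => /(_ gap); rewrite -(inflow_sub S u) /F; lra.
Qed.

(** The gap [e = 0] is always available, since the top set holds the largest positions. *)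
Lemma top_potential_nonincreasing g u v : 0 <= u -> u <= v -> v <= T ->
  top_potential g.+1 v <= top_potential g.+1 u.
Proof.
move=> u0 uv vT; have [C C0 HC] := top_potential_drift.
apply: (nonincreasing_of_quadratic uv
  (continuous_total_weight (flow_weight_cont Ax)) (C := C *+ m.+1)).
move=> a b ua ab bv.
have := HC g a b 0 (le_trans u0 ua) ab (le_trans bv vT).
rewrite mulr0 mul0r subr0; apply => i j; rewrite subr_ge0.
move=> /imsetP[p]; rewrite inE => pg -> jS.
have [q jq] : exists q, j = sorting g.+1 b q.
  by exists ((sorting g.+1 b)^-1%g j); rewrite permKV.
rewrite jq; apply: sorting_antitone; rewrite leqNgt; apply: contra jS => qp.
apply/imsetP; exists q; rewrite // inE.
exact: leq_trans (ltnW qp) pg.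
Qed.

Lemma sum_top_weight1 (z : I -> R) :
  \sum_(k < m.+1) top_weight K 1 k * z k = z ord0.
Proof.
rewrite big_ord_recl /= big1 ?addr0 => [|k _].
  by rewrite /top_weight expr0 mul1r.
by rewrite /top_weight mul0r.
Qed.

(** The potential with a single weight is the maximum of the positions. *)
Lemma upper_bound_preserved M u v : 0 <= u -> u <= v -> v <= T ->
  (forall i, x i u <= M) -> forall i, x i v <= M.
Proof.
move=> u0 uv vT xM i.
have := top_potential_ge 1 v (tperm ord0 i).
rewrite (sum_top_weight1 (fun k => x (tperm ord0 i k) v)) tpermL => /le_trans; apply.
apply: (le_trans (top_potential_nonincreasing 0 u0 uv vT)).
by rewrite /top_potential (sum_top_weight1 (fun k => x (sorting 1 u k) u)).
Qed.

(** Let [U] be the maximum of [c] and the positions outside [S]. An agent realising [U] is pulled up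
    only by agents of [S], over a distance at most [M - c], and the weights involved are part of the
    outflow. *)
Lemma rise_le_outflow M c S u v : 0 <= u -> u <= v -> v <= T ->
  (forall i t, u <= t -> t <= v -> x i t <= M) -> c <= M ->
  (forall j, j \notin S -> x j u <= c) ->
  forall j, j \notin S -> x j v - c <= (M - c) * outflow A S u v.
Proof.
move=> u0 uv vT xM cM xc j jS.
have [C C0 HC] := flow_frozen Ax.
pose U t := \big[Num.max/c]_(k | k \notin S) x k t.
pose F t := U t - (M - c) * outflow A S u t.
have Uu : U u <= c by apply: bigmax_le.
have xU t k : k \notin S -> x k t <= U t.
  by move=> kS; exact: (le_bigmax_cond _ (fun k => x k t)).
have cU t : c <= U t by exact: bigmax_ge_id.
have out0 a b : a <= b -> 0 <= outflow A S a b.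
  move=> ab; apply: sumr_ge0 => i _; apply: sumr_ge0 => k _.
  by rewrite subr_ge0; exact: (flow_mono Ax).
suff : F v <= F u.
  rewrite /F (_ : outflow A S u u = 0); last first.
    by rewrite -(outflow_sub S u) subrr.
  by have := xU v j jS; move: Uu; rewrite mulr0 subr0; lra.
apply: (nonincreasing_of_quadratic uv
  (continuous_total_weight (flow_weight_cont Ax)) (C := C)).
move=> a b ua ab bv; rewrite /F.
set D := _ ^+ 2; have D0 : 0 <= D by exact: sqr_ge0.
have CD : 0 <= C * D by exact: mulr_ge0.
rewrite (_ : _ - _ - _ = U b - U a - (M - c) * outflow A S a b); last first.
  by rewrite -(outflow_sub S u a b); ring.
have outM : 0 <= (M - c) * outflow A S a b by rewrite mulr_ge0 ?subr_ge0 ?out0.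
(* If the maximum at [b] is the floor [c], then [U] has not risen, because [c <= U a]. *)
rewrite lerBlDr; case: (bigmax_attained (fun k => k \notin S) c (fun k => x k b)).
  by rewrite -/(U b) => ->; have := cU a; lra.
move=> [k kS]; rewrite -/(U b) => Ub.
have := HC k a b (le_trans u0 ua) ab (le_trans bv vT).
rewrite ler_norml -/D => /andP[_].
have sumk : \sum_i (A k i b - A k i a) * (x i b - x k b) <=
            (M - c) * outflow A S a b.
  rewrite /outflow exchange_big /= [in leRHS](bigD1 k) ?inE //=.
  rewrite (bigID (mem S)) /= [leRHS]mulrDr mulr_sumr.
  apply: lerD.
    apply: ler_sum => i iS; rewrite mulrC; apply: ler_wpM2r.
      by rewrite subr_ge0; exact: (flow_mono Ax).
    by have := xM i b (le_trans ua ab) bv; have := cU b; rewrite Ub; lra.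
  apply: (@le_trans _ _ 0).
    apply: sumr_le0 => i iS; apply: mulr_ge0_le0.
      by rewrite subr_ge0; exact: (flow_mono Ax).
    by rewrite -Ub subr_le0; exact: xU.
  rewrite mulr_ge0 ?subr_ge0 // sumr_ge0 // => i _; apply: sumr_ge0 => l _.
  by rewrite subr_ge0; exact: (flow_mono Ax).
have := xU a k kS; rewrite Ub; lra.
Qed.

(** Otherwise sortedness would confine all agents above [c] to ranks below [k], of which there are
    only [k]. *)
Lemma sorting_above g t c (k : I) :
  (k < #|[set i | (c < x i t)%R]%SET|)%N -> c < x (sorting g t k) t.
Proof.
move=> kc; rewrite ltNge; apply/negP => xc; move: kc; apply/negP; rewrite -leqNgt.
set s := sorting g t.
have /subset_leq_card/leq_trans : [set i | (c < x i t)%R]%SET \subset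
    [set s i | i : I & (i < k)%N]%SET.
  apply/fintype.subsetP => i; rewrite inE => ci.
  apply/imsetP; exists (s^-1%g i); last by rewrite permKV.
  rewrite inE ltnNge; apply/negP => /(sorting_antitone g t).
  rewrite -/s permKV => /le_trans /(_ xc); apply/negP; rewrite -ltNge.
  exact: ci.
apply; rewrite (card_imset _ (@perm_inj _ s)).
rewrite (_ : #|_| = #|[set widen_ord (ltnW (ltn_ord k)) i | i : 'I_k]%SET|).
  by rewrite card_imset ?card_ord // => i j /(congr1 val) /= /val_inj.
apply: eq_card => i; rewrite !inE.
apply/idP/imsetP => [ik|[j _ ->]] /=; last exact: ltn_ord.
by exists (Ordinal ik) => //; apply: val_inj.
Qed.

Lemma card_top_set g t : (g < m.+1)%N -> #|top_set g t| = g.+1.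
Proof.
move=> gm; rewrite (card_imset _ (@perm_inj _ _)).
rewrite (_ : #|_| = #|[set widen_ord gm i | i : 'I_g.+1]%SET|).
  by rewrite card_imset ?card_ord // => i j /(congr1 val) /= /val_inj.
apply: eq_card => i; rewrite !inE; apply/idP/imsetP => [ik|[j _ ->]] /=.
  by exists (Ordinal (ik : (i < g.+1)%N)) => //; apply: val_inj.
by rewrite -ltnS ltn_ord.
Qed.

(** All terms except that of rank [k] are bounded through [M]. Read backwards, a potential near its
    largest possible value forces each rank up to [g] to be near [M]. *)
Lemma top_potential_le_max M t g (k : I) : (forall i, x i t <= M) -> (k <= g)%N ->
  top_potential g.+1 t <= M * (\sum_(k < m.+1) top_weight K g.+1 k) -
    K^-1 ^+ k * (M - x (sorting g.+1 t k) t).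
Proof.
move=> xM kg; rewrite /top_potential mulr_sumr (bigD1 k) //= [in leRHS](bigD1 k) //=.
rewrite {1 3}/top_weight ltnS kg.
have : \sum_(i < m.+1 | i != k) top_weight K g.+1 i * x (sorting g.+1 t i) t <=
       \sum_(i < m.+1 | i != k) M * top_weight K g.+1 i.
  by apply: ler_sum => i _; rewrite mulrC ler_wpM2r // top_weight_ge0.
lra.
Qed.

(** By contradiction: if more than [h] agents stay above the threshold for every [h <= g], the
    potential ends within [d / 16 * P] of [M * W], whereas the inflow makes it fall below [M * W] by
    at least [d / 8 * P]. *)
Lemma shrink_step M d s s' g : 0 <= s -> s <= s' -> s' <= T -> 0 < d ->
  (forall i t, s <= t -> t <= s' -> x i t <= M) ->
  #|[set i | (M - d < x i s)%R]%SET| = g.+1 -> (g < m)%N ->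
  (forall S, nonempty_proper S -> 1 <= inflow A S s s') ->
  exists2 h, (h <= g)%N &
    (#|[set i | (M - d * ((16 * m.+1%:R)^-1 / K) ^+ (g.+1 - h) < x i s')%R]%SET|
       <= h)%N.
Proof.
move=> s0 ss' s'T d0 xM cardT gm cuts; apply: contrapT => noh.
set q := (16 * m.+1%:R)^-1 in noh.
have K0 : 0 < K by apply: lt_le_trans K1.
have q0 : 0 < q by rewrite invr_gt0 mulr_gt0.
have q1 : q <= 1.
  by rewrite invf_le1 ?mulr_gt0 // -natrM ler1n muln_gt0.
pose W := \sum_(k < m.+1) top_weight K g.+1 k.
pose P := K^-1 ^+ g.+1.
have P0 : 0 < P by rewrite exprn_gt0 // invr_gt0.
have Vs' : M * W - d / 16 * P <= top_potential g.+1 s'.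
  (* The factor 1/(16 [m.+1]) in [q] is chosen so that a loss of [d * q * P] for each of the [m.+1]
     ranks adds up to [d / 16 * P]. *)
  rewrite (_ : d / 16 * P = \sum_(k < m.+1) d * q * P); last first.
    by rewrite sumr_const card_ord -mulr_natr /q; field.
  rewrite /W mulr_sumr -sumrB.
  apply: ler_sum => k _; rewrite /top_weight ltnS.
  case: (leqP k g) => kg; last first.
    by rewrite mulr0 mul0r sub0r oppr_le0 ltW // !mulr_gt0.
  have kx : M - d * (q / K) ^+ (g.+1 - k) < x (sorting g.+1 s' k) s'.
    apply: sorting_above; rewrite ltnNge; apply/negP => ?; apply: noh.
    by exists k.
  have Kk0 : 0 <= K^-1 ^+ k by rewrite exprn_ge0 // invr_ge0 ltW.
  apply: (le_trans _ (ler_wpM2l Kk0 (ltW kx))).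
  rewrite mulrBr mulrC lerD2l lerN2 /P.
  rewrite -[in leRHS](subnK (leqW kg)) exprD exprMn.
  rewrite [leLHS](_ : _ = (d * (K^-1 ^+ (g.+1 - k) * K^-1 ^+ k)) * q ^+ (g.+1 - k));
    last by ring.
  rewrite [leRHS]mulrAC; apply: ler_wpM2l.
    by rewrite mulr_ge0 ?(ltW d0) // mulr_ge0 // exprn_ge0 // invr_ge0 ltW.
  by rewrite subSn // exprS ler_piMr ?(ltW q0) // exprn_ile1 // ltW.
have VV t : s <= t -> t <= s' -> M * W - d / 16 * P <= top_potential g.+1 t.
  move=> st ts'; apply: (le_trans Vs').
  by apply: top_potential_nonincreasing => //; apply: le_trans st.
(* As the potential is nonincreasing, its lower bound at [s'] holds throughout [[s, s']] and keeps
   the first [g.+1] ranks high all along. *)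
have high t (i : I) : s <= t -> t <= s' -> (i <= g)%N ->
    M - d / 16 <= x (sorting g.+1 t i) t.
  move=> st ts' ig.
  have := top_potential_le_max (fun i => xM i t st ts') ig.
  move=> /(le_trans (VV t st ts')).
  rewrite -/W lerD2l lerN2 => h.
  have : P * (M - x (sorting g.+1 t i) t) <= P * (d / 16).
    rewrite [leRHS]mulrC; apply: le_trans h; apply: ler_wpM2r.
      by rewrite subr_ge0 xM.
    rewrite /P -(subnK (leqW ig)) exprD ler_piMl ?exprn_ge0 ?invr_ge0 ?(ltW K0) //.
    by rewrite exprn_ile1 ?invr_ge0 ?(ltW K0) // invf_le1.
  by rewrite ler_pM2l //; lra.
pose S := [set i | (M - d < x i s)%R]%SET.
have SP : nonempty_proper S.
  rewrite /nonempty_proper -card_gt0 cardT /= finset.properEcard finset.subsetT.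
  by rewrite cardT cardsT card_ord ltnS.
pose U t := \big[Num.max/(M - d)]_(j | j \notin S) x j t.
have cU : continuous U by apply: continuous_bigmax; exact: (flow_cont Ax).
have xU t j : j \notin S -> x j t <= U t.
  by move=> jS; exact: (le_bigmax_cond _ (fun k => x k t)).
have Us : U s <= M - d.
  by apply: bigmax_le => // j; rewrite inE -leNgt.
(* Take for [t1] the first time an agent outside [S] reaches [M - d / 2], or [s'] if none does. In
   the first case the rise by [d / 2] requires outflow at least 1/2, and balance converts this into
   inflow. *)
have [t1 [st1 t1s' Ut1 in1]] : exists t1, [/\ s <= t1, t1 <= s',
    forall r, s <= r -> r <= t1 -> U r <= M - d / 2 &
    1 / 2 <= K * inflow A S s t1].
  have [[v [sv vs' Uv]]|nov] :=
      pselect (exists v, [/\ s <= v, v <= s' & M - d / 2 <= U v]); last first.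
    exists s'; split => //.
      move=> r sr rs'; rewrite leNgt; apply/negP => /ltW Ur.
      by apply: nov; exists r.
    apply: (@le_trans _ _ (1 * 1)); first by lra.
    by apply: ler_pM => //; exact: cuts.
  have [|t1 /andP[st1 t1v] [Ut1 below]] := first_hitting sv cU _ Uv.
    by move: Us d0; lra.
  have t1s' := le_trans t1v vs'.
  exists t1; split => //.
    move=> r sr; rewrite le_eqVlt => /orP[/eqP ->|/(below _ sr)/ltW //].
    by rewrite Ut1.
  apply: le_trans (flow_balanced Ax SP s0 st1 (le_trans t1s' s'T)).
  have [j jS Uj] : exists2 j, j \notin S & U t1 = x j t1.
    have := bigmax_attained (fun j => j \notin S) (M - d) (fun j => x j t1).
    by rewrite -/(U t1) Ut1 => -[|//]; move: d0; lra.
  have := @rise_le_outflow M (M - d) S s t1 s0 st1 (le_trans t1s' s'T) _ _ _ j jS.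
  rewrite -Uj Ut1 (_ : M - (M - d) = d); last by ring.
  rewrite (_ : M - d / 2 - (M - d) = d * (1 / 2)); last by field.
  rewrite ler_pM2l //; apply.
  - by move=> i t st tt1; apply: xM => //; exact: le_trans t1s'.
  - by rewrite gerBl ltW.
  - by move=> k; rewrite inE -leNgt.
have := @top_potential_drop g s t1 (d / 4) S s0 st1 (le_trans t1s' s'T).
move=> /(_ _)/wrap[t st tt1|drop].
  have ts' := le_trans tt1 t1s'.
  (* The top ranks are above [M - d / 16] and agents outside [S] at most [M - d / 2], so the top set
     lies in [S]; both have [g.+1] members. *)
  have topS : top_set g t = S.
    apply/eqP; rewrite finset.eqEcard card_top_set ?cardT ?leqnn ?andbT ?ltnS 1?ltnW //.
    apply/fintype.subsetP => l /imsetP[i]; rewrite inE => ig ->.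
    apply: contraT => /(xU t) /le_trans /(_ (Ut1 t st tt1)).
    by have := high t i st ts' ig; move: d0; lra.
  split => // i j; rewrite -[in i \in _]topS => /imsetP[p]; rewrite inE => pg -> jS.
  have := high t p st ts' pg; have := xU t j jS; have := Ut1 t st tt1.
  by move: d0; lra.
have V1 : top_potential g.+1 s <= M * W.
  rewrite /top_potential mulr_sumr; apply: ler_sum => k _.
  by rewrite mulrC ler_wpM2r ?top_weight_ge0 // xM.
have := VV t1 st1 t1s'.
have Pg : K^-1 ^+ g = K * P by rewrite /P exprS mulrA mulfV ?mul1r // gt_eqF.
have : P * (d / 4) * (1 / 2) <= K^-1 ^+ g * (d / 4) * inflow A S s t1.
  rewrite Pg (_ : K * P * (d / 4) * inflow A S s t1 =
              P * (d / 4) * (K * inflow A S s t1)); last by ring.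
  by apply: ler_wpM2l => //; rewrite mulr_ge0 ?(ltW P0) // divr_ge0 ?(ltW d0).
have : 0 < P * d by exact: mulr_gt0.
move: drop V1; lra.
Qed.

Definition shrink_factor : R := (16 * m.+1%:R)^-1 / K.

Lemma shrink_factor_gt0 : 0 < shrink_factor.
Proof. by rewrite divr_gt0 ?invr_gt0 ?mulr_gt0 //; apply: lt_le_trans K1. Qed.

Lemma shrink_factor_le1 : shrink_factor <= 1.
Proof.
rewrite -[leRHS]mulr1 ler_pM ?invr_ge0 ?invf_le1 //; first exact: le_trans K1.
  by rewrite -natrM ler1n muln_gt0.
exact: lt_le_trans K1.
Qed.

(** Induction over the intervals: each one lowers the number of agents above the threshold and pays
    one factor [shrink_factor] for each unit by which the bound on that number drops. *)
Lemma upper_bound_shrinks M d h (tau : nat -> R) : 0 <= tau 0%N ->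
  (forall q, (q < h)%N -> tau q <= tau q.+1) -> tau h <= T -> 0 < d ->
  (forall i, x i (tau 0%N) <= M) -> (h <= m)%N ->
  (#|[set i | (M - d < x i (tau 0%N))%R]%SET| <= h)%N ->
  (forall q S, (q < h)%N -> nonempty_proper S ->
     1 <= inflow A S (tau q) (tau q.+1)) ->
  forall i, x i (tau h) <= M - d * shrink_factor ^+ h.
Proof.
move=> tau0 tauS tauT d0 xM hm count0 cuts.
have r0 := shrink_factor_gt0; have r1 := shrink_factor_le1.
have tau_mono p q : (p <= q)%N -> (q <= h)%N -> tau p <= tau q.
  elim: q => [|q IH]; first by rewrite leqn0 => /eqP ->.
  rewrite leq_eqVlt => /orP[/eqP -> //|pq qh].
  exact: le_trans (IH pq (ltnW qh)) (tauS q qh).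
have xMt i t : tau 0%N <= t -> t <= tau h -> x i t <= M.
  by move=> t0 th; apply: upper_bound_preserved xM i => //; exact: le_trans tauT.
have powM p q : (p <= q)%N -> d * shrink_factor ^+ q <= d * shrink_factor ^+ p.
  move=> pq; rewrite ler_pM2l // -(subnK pq) exprD ler_piMl ?exprn_ge0 ?(ltW r0) //.
  by rewrite exprn_ile1 // ltW.
have claim q : (q <= h)%N -> exists2 g, (g <= h - q)%N &
    (#|[set i | (M - d * shrink_factor ^+ (h - g) < x i (tau q))%R]%SET| <= g)%N.
  elim: q => [_|q IH qh]; first by exists h; rewrite ?subn0 // subnn expr0 mulr1.
  have [g gh] := IH (ltnW qh).
  have q0 : tau 0%N <= tau q by apply: tau_mono => //; exact: ltnW.
  have qT : tau q.+1 <= tau h by exact: tau_mono.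
  (* If no agent is above the threshold, the preserved upper bound keeps it so; otherwise
     [shrink_step] applies. *)
  case cardE : #|_| => [|g'] g'g.
    exists 0%N => //; rewrite leqn0; apply/eqP/eqP; rewrite cards_eq0.
    apply/eqP/setP => i; rewrite !inE; apply/negbTE; rewrite -leNgt.
    apply: (@upper_bound_preserved _ (tau q)); rewrite ?(le_trans tau0) ?tauS //.
      exact: le_trans qT tauT.
    move=> k; rewrite subn0; apply: (@le_trans _ _ (M - d * shrink_factor ^+ (h - g))).
      move/eqP: cardE; rewrite cards_eq0 => /eqP/setP/(_ k); rewrite !inE.
      by move/negbT; rewrite -leNgt.
    by rewrite lerD2l lerN2 powM // leq_subr.
  have [] := @shrink_step M (d * shrink_factor ^+ (h - g)) (tau q) (tau q.+1) g'
    _ _ _ _ _ cardE.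
  - exact: le_trans q0.
  - exact: tauS.
  - exact: le_trans qT tauT.
  - by rewrite mulr_gt0 // exprn_gt0.
  - move=> i t qt tq; apply: xMt; first exact: le_trans qt.
    exact: le_trans tq qT.
  - apply: leq_trans g'g _; apply: leq_trans gh _.
    by apply: leq_trans hm; exact: leq_subr.
  - by move=> S SP; exact: cuts.
  move=> h' h'g' count; exists h'.
    rewrite -ltnS; apply: leq_trans (_ : h - q <= _)%N; last by rewrite -subSn.
    by apply: leq_ltn_trans h'g' _; apply: leq_trans gh.
  apply: leq_trans count; apply: subset_leq_card; apply/fintype.subsetP => i.
  rewrite !inE; apply: le_lt_trans; rewrite lerD2l lerN2.
  (* The exponents add up to at most [h - h'] because [g'.+1 <= g]. *)
  rewrite -mulrA -exprD; apply: powM.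
  have gh' : (g <= h)%N by apply: leq_trans gh (leq_subr _ _).
  lia.
have [g] := claim h (leqnn h); rewrite subnn leqn0 => /eqP ->.
rewrite leqn0 cards_eq0 subn0 => /eqP/setP none i.
by move: (none i); rewrite !inE => /negbT; rewrite -leNgt.
Qed.

End fixed_flow.

(** The equations are odd in the positions, so every upper estimate yields a lower one. *)
Lemma flowN A x K T : flow A x K T -> flow A (fun i t => - x i t) K T.
Proof.
move=> [cA mA cx [C C0 HC] K1 bal]; split => //.
  by move=> i t; apply: cvgN; exact: cx.
exists C => // i u v u0 uv vT; have := HC i u v u0 uv vT.
have -> : \sum_j (A i j v - A i j u) * (- x j v - - x i v) =
    - \sum_j (A i j v - A i j u) * (x j v - x i v).
  by rewrite -sumrN; apply: eq_bigr => j _; ring.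
by rewrite -normrN; congr (`| _ | <= _); ring.
Qed.

Lemma diameter_shrinks A x K T a0 b0 (tau : nat -> R) : flow A x K T ->
  (0 < m)%N -> 0 <= tau 0%N ->
  (forall q, (q < m.+1./2)%N -> tau q <= tau q.+1) -> tau m.+1./2 <= T ->
  (forall i, a0 <= x i (tau 0%N) <= b0) ->
  (forall q S, (q < m.+1./2)%N -> nonempty_proper S ->
     1 <= inflow A S (tau q) (tau q.+1)) ->
  exists a1 b1, (forall i, a1 <= x i (tau m.+1./2) <= b1) /\
    b1 - a1 <= (b0 - a0) * (1 - shrink_factor K ^+ m.+1./2 / 2).
Proof.
move=> Ax m0 tau0 tauS tauT xab cuts; set h := m.+1./2 in tauS tauT cuts *.
have Nx := flowN Ax.
have hm : (h <= m)%N by rewrite /h; lia.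
have tau_h : tau 0%N <= tau h.
  have : forall q, (q <= h)%N -> tau 0%N <= tau q.
    by elim=> // q IH qh; apply: le_trans (IH (ltnW qh)) (tauS q qh).
  exact.
have ub i : x i (tau h) <= b0.
  by apply: (upper_bound_preserved Ax tau0 tau_h tauT) => j; case/andP: (xab j).
have lb i : a0 <= x i (tau h).
  rewrite -lerN2; apply: (upper_bound_preserved Nx tau0 tau_h tauT (M := - a0)) => j.
  by rewrite lerN2; case/andP: (xab j).
have ab : a0 <= b0 by case/andP: (xab ord0); exact: le_trans.
have [eqab|d0] := eqVneq a0 b0.
  by exists a0, b0; rewrite eqab subrr mul0r; split => // i; rewrite -eqab lb eqab ub.
have {}d0 : 0 < (b0 - a0) / 2 by rewrite divr_gt0 // subr_gt0 lt_neqAle d0.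
set d := (b0 - a0) / 2 in d0.
pose P := [set i | (b0 - d < x i (tau 0%N))%R]%SET.
pose Q := [set i | (- a0 - d < - x i (tau 0%N))%R]%SET.
(* The inequalities are strict, so an agent at the midpoint is in neither group and the groups are
   disjoint. *)
have PQ : (#|P| + #|Q| <= m.+1)%N.
  rewrite -cardsUI (_ : P :&: Q = finset.set0) ?cards0 ?addn0.
    by rewrite -[leqRHS]card_ord max_card.
  apply/setP => i; rewrite !inE /d; apply/negbTE/negP => /andP[]; lra.
have [Ph|Qh] : (#|P| <= h)%N \/ (#|Q| <= h)%N.
  by rewrite /h; have := odd_double_half m.+1; lia.
- exists a0, (b0 - d * shrink_factor K ^+ h); split.
    move=> i; rewrite lb /=; apply: (upper_bound_shrinks Ax) => // j.
    by case/andP: (xab j).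
  by rewrite /d; lra.
- exists (a0 + d * shrink_factor K ^+ h), b0; split.
    move=> i; rewrite ub andbT -lerN2 opprD.
    apply: (upper_bound_shrinks Nx) => // j.
    by rewrite lerN2; case/andP: (xab j).
  by rewrite /d; lra.
Qed.

End flow.

(** * Integrals of the weights *)

Section weighted_sums.
Context d (T : measurableType d) (R : realType) (mu : {measure set T -> \bar R}).
Variables (D : set T) (I : finType) (P : pred I) (f : I -> T -> R).
Hypothesis mD : measurable D.
Hypothesis intf : forall j, mu.-integrable D (EFin \o f j).

Lemma Rintegral_sum : \int[mu]_(s in D) (\sum_(j | P j) f j s) =
  \sum_(j | P j) \int[mu]_(s in D) f j s.
Proof.
rewrite /Rintegral.
rewrite (eq_integral (fun s => (\sum_(j | P j) (EFin \o f j) s)%E)); last first.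
  by move=> s _; rewrite /= sumEFin.
rewrite (integral_sum mD) //.
by rewrite -sum_fine // => j _; exact: integrable_fin_num.
Qed.

Lemma integrable_Rsum : mu.-integrable D (EFin \o (fun s => \sum_(j | P j) f j s)).
Proof.
rewrite (_ : EFin \o _ = fun s => (\sum_(j | P j) (EFin \o f j) s)%E); last first.
  by apply/funext => s; rewrite /= sumEFin.
exact: integrable_sum.
Qed.

Lemma integrable_weighted (c : I -> T -> R) (B : R) :
  (forall j, measurable_fun D (c j)) ->
  (forall j s, D s -> `|c j s| <= B) ->
  forall j, mu.-integrable D (EFin \o (fun s => f j s * c j s)).
Proof.
move=> mc cB j.
have -> : EFin \o (fun s => f j s * c j s) = ((EFin \o f j) \* (EFin \o c j))%E.
  by apply/funext => s; rewrite /= EFinM.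
apply: integrableMl => //; exists B; split; first exact: num_real.
by move=> M BM s Ds; apply: le_trans (cB j s Ds) (ltW BM).
Qed.

End weighted_sums.

Lemma integrable_mulr d (T : measurableType d) (R : realType)
    (mu : {measure set T -> \bar R}) (D : set T) (f : T -> R) (k : R) :
  measurable D -> mu.-integrable D (EFin \o f) ->
  mu.-integrable D (EFin \o (fun s => f s * k)).
Proof.
move=> mD intf; have := integrableZr mD k intf.
by congr (mu.-integrable D _); apply/funext => s /=; rewrite EFinM.
Qed.

Lemma integrable_mull d (T : measurableType d) (R : realType)
    (mu : {measure set T -> \bar R}) (D : set T) (f : T -> R) (k : R) :
  measurable D -> mu.-integrable D (EFin \o f) ->
  mu.-integrable D (EFin \o (fun s => k * f s)).
Proof.
move=> mD intf; have := integrable_mulr k mD intf.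
by congr (mu.-integrable D _); apply/funext => s /=; rewrite mulrC.
Qed.

Lemma normr_Rintegral_weighted d (T : measurableType d) (R : realType)
    (mu : {measure set T -> \bar R}) (D : set T) (n : nat)
    (f c : 'I_n -> T -> R) (B : R) : measurable D ->
  (forall j, mu.-integrable D (EFin \o f j)) ->
  (forall j, measurable_fun D (c j)) ->
  (forall j s, D s -> 0 <= f j s) -> (forall j s, D s -> `|c j s| <= B) ->
  `|\int[mu]_(s in D) (\sum_(j < n) f j s * c j s)| <=
  B * \sum_(j < n) \int[mu]_(s in D) f j s.
Proof.
move=> mD intf mc f0 cB.
have intfc j := integrable_weighted mD intf mc cB j.
have intsum : mu.-integrable D (EFin \o (fun s => \sum_(j < n) f j s * c j s)).
  exact: integrable_Rsum.
apply: (le_trans (le_normr_Rintegral mD intsum)).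
rewrite -(Rintegral_sum xpredT mD intf) -RintegralZl //; last exact: integrable_Rsum.
apply: le_Rintegral => //.
- have := integrable_abse intsum; congr (mu.-integrable D _).
- exact: (integrable_mull B mD (integrable_Rsum xpredT mD intf)).
- move=> s Ds; apply: (le_trans (ler_norm_sum _ _ _)).
  rewrite mulr_sumr; apply: ler_sum => j _.
  by rewrite normrM (ger0_norm (f0 j s Ds)) mulrC ler_wpM2r ?f0 ?cB.
Qed.

(** Clamping time at 0 extends a function from the half-line to one continuous everywhere, as [flow]
    requires. The clamp is 1-Lipschitz, so uniform continuity on each [[0, N]] suffices. *)
Lemma continuous_extension (R : realType) (f : R -> R) :
  (forall N e : R, 0 <= N -> 0 < e -> exists2 d, 0 < d &
    forall u v, 0 <= u -> u <= v -> v <= N -> v - u < d -> `|f v - f u| < e) ->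
  continuous (f \o Num.max 0).
Proof.
move=> unif t; apply/cvgrPdist_lt => e e0 /=.
pose N := `|t| + 1.
have N0 : 0 <= N by rewrite addr_ge0.
have [d d0 small] := unif N e N0 e0.
have dist_max (a b : R) : `|Num.max 0 a - Num.max 0 b| <= `|a - b|.
  have := ler_norm (a - b); have := ler_norm (b - a); rewrite (distrC b).
  by rewrite !maxElt; case: ltP => ?; case: ltP => ?; rewrite ler_norml; lra.
have d1 : 0 < Num.min d 1 by rewrite lt_min d0 ltr01.
near=> r.
have : `|t - r| < Num.min d 1 by near: r; exact: cvgr_dist_lt.
rewrite lt_min => /andP[rd r1].
have max0 (a : R) : 0 <= Num.max 0 a by rewrite le_max lexx.
have tN : Num.max 0 t <= N.
  by rewrite ge_max N0 /= /N; have := ler_norm t; lra.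
have rN : Num.max 0 r <= N.
  rewrite ge_max N0 /= /N; have := ler_norm t; move: r1; rewrite ltr_norml; lra.
have := le_lt_trans (dist_max t r) rd; rewrite ltr_norml => /andP[h1 h2].
case: (leP (Num.max 0 t) (Num.max 0 r)) => tr.
  by rewrite distrC; apply: small => //; lra.
by apply: small => //; exact: ltW.
Unshelve. all: by end_near. Qed.

(** * Primitives for the completed Lebesgue measure *)

Section primitive.
Variable R : realType.
Local Notation mu := (@completed_lebesgue_measure R).
Local Notation T := (lebesgue_type R).

Lemma borel_completed (A : set R) : measurable A -> measurable (A : set T).
Proof. by move=> mA; apply: sub_caratheodory; exact: mA. Qed.

Lemma measurable_completed_itv (i : interval R) : measurable ([set` i] : set T).
Proof. by apply: borel_completed; exact: measurable_itv. Qed.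

Lemma measurable_fun_completed (D : set R) (f : R -> R) :
  measurable D -> measurable_fun D f -> measurable_fun (D : set T) f.
Proof. by move=> mD mf _ Y mY; apply: borel_completed; exact: mf. Qed.

Lemma completed_itv_oc (u v : R) : u <= v -> mu `]u, v]%classic = (v - u)%:E.
Proof.
move=> uv; rewrite -[LHS]/(lebesgue_measure `]u, v]%classic) lebesgue_measure_itv.
rewrite /= lte_fin; case: ltgtP uv => // -> _.
by rewrite subrr.
Qed.

Definition locally_integrable_pos (f : R -> R) : Prop :=
  forall t, 0 <= t -> mu.-integrable `[0, t] (EFin \o f).

Variable f : R -> R.
Hypothesis intf : locally_integrable_pos f.

Definition primitive (t : R) : R := \int[mu]_(s in `[0, t]) f s.

(** For [t <= 0] the domain of integration is empty or a null point. *)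
Lemma primitive_max t : primitive t = primitive (Num.max 0 t).
Proof.
rewrite maxElt; case: ltP => // t0; rewrite /primitive.
move: t0; rewrite le_eqVlt => /orP[/eqP -> //|t0].
rewrite [in LHS](_ : `[0, t]%classic = set0); last first.
  by apply/seteqP; split=> r //=; rewrite in_itv /= => /andP[]; lra.
rewrite Rintegral_set0 set_itv1.
have m0 : measurable ([set 0 : R] : set T) by apply: borel_completed.
rewrite /Rintegral null_set_integral //; last exact: (lebesgue_measure_set1 (0 : R)).
have := intf (lexx 0); rewrite set_itv1.
exact: measurable_int.
Qed.

Lemma integrable_sub_pos (D : set R) u v : 0 <= u -> D `<=` `[u, v] ->
  measurable D -> mu.-integrable D (EFin \o f).
Proof.
move=> u0 Duv mD.
have [v0|v0] := leP 0 v.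
  apply: (integrableS _ _ _ (intf v0)).
  - exact: measurable_completed_itv.
  - exact: borel_completed.
  - move=> r /Duv /=; rewrite !in_itv /=; lra.
have -> : D = set0.
  by apply/seteqP; split => r // /Duv /=; rewrite in_itv /= => /andP[]; lra.
exact: integrable_set0.
Qed.

Lemma Rintegral_oc u v : 0 <= u -> u <= v ->
  \int[mu]_(s in `]u, v]) f s = primitive v - primitive u.
Proof.
move=> u0 uv; rewrite /primitive.
have -> : `[0, v]%classic = `[0, u]%classic `|` `]u, v]%classic.
  apply/seteqP; split => r /=; rewrite !in_itv /=; last by lra.
  by move=> /andP[r0 rv]; case: (leP r u) => ru; [left|right]; lra.
have mc := @measurable_completed_itv `[0, u].
have mo := @measurable_completed_itv `]u, v].
have iU : mu.-integrable (`[0, u]%classic `|` `]u, v]%classic) (EFin \o f).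
  apply: (@integrable_sub_pos _ 0 v) => //.
    by move=> r [] /=; rewrite !in_itv /=; lra.
  by apply: measurableU; exact: measurable_itv.
have dU : [disjoint `[0, u]%classic & `]u, v]%classic]%classic.
  by apply/disj_setPRL => r /=; rewrite !in_itv /=; lra.
by rewrite (Rintegral_setU mc mo iU dU) [RHS]addrC addKr.
Qed.


(** The left end point is null. Closed intervals are those of [min_cut_weight]; half-open ones
    concatenate disjointly. *)
Lemma integral_cc u v : 0 <= u -> u <= v ->
  (\int[mu]_(s in `[u, v]) (f s)%:E)%E = (primitive v - primitive u)%:E.
Proof.
move=> u0 uv.
have m1 : measurable ([set u] : set T) by exact: borel_completed.
have mo := @measurable_completed_itv `]u, v].
have split_uv : `[u, v]%classic = [set u] `|` `]u, v]%classic.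
  apply/seteqP; split => r /=; rewrite !in_itv /=.
    move=> /andP[]; rewrite le_eqVlt => /orP[/eqP ->|ur rv]; first by left.
    by right; rewrite ur.
  by move=> [->|/andP[/ltW -> ->]//]; rewrite lexx uv.
have iU : mu.-integrable ([set u] `|` `]u, v]%classic) (EFin \o f).
  by rewrite -split_uv; exact: (@integrable_sub_pos _ u v u0 _ (measurable_itv _)).
have dU : [disjoint [set u] & `]u, v]%classic]%classic.
  apply/disj_setPRL => r /=; rewrite in_itv /= => /andP[ur _] ru.
  by move: ur; rewrite ru ltxx.
have mU := measurable_int _ iU.
rewrite split_uv (integral_setU mu m1 mo mU dU).
have m1U : [set u] `<=` [set u] `|` `]u, v]%classic by left.
have mu1 : mu [set u] = 0%E by exact: (lebesgue_measure_set1 u).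
rewrite (null_set_integral m1 (measurable_funS (measurableU _ _ m1 mo) m1U mU)
  mu1) add0e.
rewrite -Rintegral_oc // /Rintegral fineK //.
apply: integrable_fin_num => //.
by apply: (@integrable_sub_pos _ u v) => //; exact: subset_itv_oc_cc.
Qed.

(** Absolute continuity of the integral of [f] restricted to [[0, N]]. *)
Lemma primitive_continuous : continuous primitive.
Proof.
rewrite (_ : primitive = primitive \o Num.max 0); last first.
  by apply/funext => t; exact: primitive_max.
apply: continuous_extension => N e N0 e0.
have mN := @measurable_completed_itv `[0, N].
have intN : mu.-integrable setT (EFin \o (f \_ `[0, N])).
  have := (integrable_mkcond _ mN).1 (intf N0).
  by rewrite restrict_EFin.
have [d [d0 small]] := integral_normr_continuous intN e0.
exists d => // u v u0 uv vN vud.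
have mo := @measurable_completed_itv `]u, v].
have mu_oc : (mu `]u, v]%classic < d%:E)%E by rewrite completed_itv_oc // lte_fin.
apply: le_lt_trans (small _ mo mu_oc).
rewrite -Rintegral_oc //.
have iuv : mu.-integrable `]u, v] (EFin \o f).
  by apply: (@integrable_sub_pos _ u v) => //; exact: subset_itv_oc_cc.
apply: (le_trans (le_normr_Rintegral mo iuv)).
rewrite le_eqVlt; apply/orP; left; apply/eqP; apply: eq_Rintegral => r.
rewrite inE /= in_itv /= => ruv; rewrite patchE mem_set //= in_itv /=; lra.
Qed.

Hypothesis f0 : forall t, 0 <= t -> 0 <= f t.

Lemma primitive_mono u v : u <= v -> primitive u <= primitive v.
Proof.
move=> uv; rewrite primitive_max (primitive_max v) -subr_ge0.
have max0 (a : R) : 0 <= Num.max 0 a by rewrite le_max lexx.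
rewrite -Rintegral_oc //; last by rewrite ge_max max0 /= le_max uv orbT.
apply: Rintegral_ge0 => r /=; rewrite in_itv /= => /andP[ur _].
by apply: f0; apply: le_trans (ltW ur).
Qed.

(** Monotone convergence along the intervals [[0, n]]. *)
Lemma primitive_unbounded (M : R) :
  (\int[mu]_(s in `[0%R, +oo[) (f s)%:E = +oo)%E ->
  exists2 t, 0 <= t & M <= primitive t.
Proof.
move=> intoo.
have mn (n : nat) := @measurable_completed_itv `[0, n%:R : R].
pose F (n : nat) : set T := `[0, n%:R : R]%classic.
have : (\int[mu]_(s in F n) (f s)%:E)%E @[n --> \oo] -->
    (\int[mu]_(s in \bigcup_n F n) (f s)%:E)%E.
  apply: ge0_nondecreasing_set_cvg_integral => //.
  - move=> p q pq; apply/subsetPset => r /=; rewrite /F /= !in_itv /= => /andP[-> rp] /=.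
    by apply: le_trans rp _; rewrite ler_nat.
  - by move=> n; exact: measurable_int (intf (ler0n _ n)).
  - by move=> n r /=; rewrite /F /= in_itv /= => /andP[r0 _]; rewrite lee_fin f0.
rewrite (_ : \bigcup_n F n = `[0%R, +oo[%classic); last first.
  apply/seteqP; split => [r [n _]|r]; rewrite /F /= !in_itv /= ?andbT.
    by move=> /andP[].
  move=> r0; exists (Num.truncn r).+1 => //=; rewrite in_itv /= r0 /=.
  by apply/ltW; rewrite truncnS_gt.
rewrite intoo => /cvgeyPge /(_ M)[n _ /(_ n (leqnn n))] /=.
rewrite integral_cc // lee_fin => h; exists n%:R => //; apply: le_trans h _.
rewrite gerBl /primitive; apply: Rintegral_ge0 => r /=.
by rewrite in_itv /= => /andP[/f0].
Qed.

End primitive.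

(** * Trajectories *)

Lemma nonempty_proper1 (m : nat) : (0 < m)%N ->
  nonempty_proper [set ord0 : 'I_m.+1]%SET.
Proof.
move=> m0; rewrite /nonempty_proper finset.properT; apply/andP; split.
  by apply/finset.set0Pn; exists ord0; rewrite inE.
by apply/eqP => /setP/(_ ord_max); rewrite !inE => /eqP /(congr1 val) /=; lia.
Qed.

(** * Reciprocity ratios as balance of cuts *)

Section cut_ratios.
Variables (R : realType) (m : nat) (a : 'I_m.+1 -> 'I_m.+1 -> R -> R).
Hypothesis a0 : forall i j t, 0 <= t -> 0 <= a i j t.

Lemma nonempty_properC (S : {set 'I_m.+1}) :
  nonempty_proper S -> nonempty_proper (~: S).
Proof.
rewrite /nonempty_proper !finset.properT => /andP[S0 ST].
rewrite -finset.setC0 -{1}finset.setCT !(inj_eq (@finset.setC_inj _)).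
by rewrite ST S0.
Qed.

Lemma cut_ratio_balanced (S : {set 'I_m.+1}) (K t : R) : 0 <= K -> 0 <= t ->
  (cut_ratio a S t <= K%:E)%E ->
  \sum_(i in S) \sum_(j in ~: S) a i j t <=
  K * \sum_(i in S) \sum_(j in ~: S) a j i t.
Proof.
move=> K0 t0; rewrite /cut_ratio.
set num := \sum_(i in S) _; set den := \sum_(i in S) \sum_(j in ~: S) a j i t.
have den0 : 0 <= den by apply: sumr_ge0 => i _; apply: sumr_ge0 => j _; exact: a0.
case: ifPn => [den_gt0|_]; first by rewrite lee_fin ler_pdivrMr.
(* With zero denominator, a nonzero numerator would give the ratio [+oo], which the finite bound [K]
   excludes. *)
by case: eqP => [->|_]; rewrite ?mulr_ge0 // leye_eq.
Qed.

(** The ratio of [S] bounds inflow by outflow; the opposite bound needed here comes from the ratio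
    of the complement. *)
Lemma reciprocity_ratio_balanced (S : {set 'I_m.+1}) (K T t : R) :
  0 <= K -> 0 <= t -> t <= T -> nonempty_proper S ->
  (sup_reciprocity_ratio a T <= K%:E)%E ->
  \sum_(i in S) \sum_(j in ~: S) a j i t <=
  K * \sum_(i in S) \sum_(j in ~: S) a i j t.
Proof.
move=> K0 t0 tT SP supK.
have ratioK : (cut_ratio a (~: S) t <= K%:E)%E.
  apply: le_trans supK; apply: (@le_trans _ _ (reciprocity_ratio a t)).
    exact: (le_bigmax_cond _ (fun S => cut_ratio a S t) (nonempty_properC SP)).
  by apply: ereal_sup_ubound; exists t => //=; rewrite in_itv /= t0.
have := cut_ratio_balanced K0 t0 ratioK.
by rewrite finset.setCK exchange_big /= [X in _ <= K * X -> _]exchange_big.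
Qed.

(** The ratios of a cut and of its complement are inverse to each other, so one of them is at least
    1. *)
Lemma sup_reciprocity_ratio_ge1 (T : R) : (0 < m)%N -> 0 <= T ->
  (1%E <= sup_reciprocity_ratio a T)%E.
Proof.
move=> m0 T0; apply: (@le_trans _ _ (reciprocity_ratio a 0)); last first.
  by apply: ereal_sup_ubound; exists 0 => //=; rewrite in_itv /= lexx.
set S := [set ord0 : 'I_m.+1]%SET.
have SP : nonempty_proper S by exact: nonempty_proper1.
have cutS := le_bigmax_cond -oo%E (fun S => cut_ratio a S 0) SP.
have cutC := le_bigmax_cond -oo%E (fun S => cut_ratio a S 0) (nonempty_properC SP).
have [|lt1] := leP 1%E (cut_ratio a S 0); first by move=> /le_trans; apply.
apply: le_trans cutC; move: lt1; rewrite /cut_ratio finset.setCK.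
rewrite [\sum_(i in ~: S) \sum_(j in S) a i j 0]exchange_big.
rewrite [\sum_(i in ~: S) \sum_(j in S) a j i 0]exchange_big /=.
set p := \sum_(i in S) \sum_(j in ~: S) a i j 0.
set q := \sum_(i in S) \sum_(j in ~: S) a j i 0.
have p0 : 0 <= p by apply: sumr_ge0 => i _; apply: sumr_ge0 => j _; exact: a0.
case: ifPn => [q0|_].
  rewrite lte_fin ltr_pdivrMr // mul1r => pq; case: ifPn => [pp|_].
    by rewrite lee_fin ler_pdivlMr // mul1r ltW.
  by case: eqP => // _; rewrite leey.
by case: eqP => [_|_]; rewrite ?ltxx.
Qed.

End cut_ratios.

(** * Trajectories as flows *)

Section flow_of_trajectory.
Variables (R : realType) (m : nat) (a : 'I_m.+1 -> 'I_m.+1 -> R -> R)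
  (x : 'I_m.+1 -> R -> R).
Hypotheses (ha : admissible_weights a) (hx : trajectory a x).
Local Notation mu := (@completed_lebesgue_measure R).
Local Notation A := (fun i j => primitive (a i j)).
Local Notation y := (fun i => x i \o Num.max 0).

Let a0 i j t : 0 <= t -> 0 <= a i j t.
Proof. by have [h _ _] := ha i j; exact: h. Qed.

Let inta i j : locally_integrable_pos (a i j).
Proof. by have [_ _ h] := ha i j; exact: h. Qed.

Lemma trajectory_continuous i : continuous (y i).
Proof.
apply: continuous_extension => N e N0 e0.
have [d d0 small] := hx.1 i N N0 e e0.
exists d => // u v u0 uv vN vud.
have := small 1%N (fun=> u) (fun=> v); rewrite !big_ord1; apply => //.
by move=> p q _ _ _; rewrite !ord1.
Qed.

Lemma trajectory_bounded (t : R) : exists2 M, 0 <= M &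
  forall i s, 0 <= s -> s <= t -> `|y i s| <= M.
Proof.
have [t0|t0] := leP 0 t; last by exists 0 => // i s s0 st; lra.
have bnd i : exists M, forall s, 0 <= s -> s <= t -> `|y i s| <= M.
  have cy : {within `[0, t], continuous (fun s => `|y i s|)}.
    apply: continuous_subspaceT => s.
    by apply: cvg_norm; exact: (@trajectory_continuous i s).
  have [c _ cmax] := EVT_max t0 cy.
  by exists `|y i c| => s s0 st; apply: cmax; rewrite in_itv /= s0.
have [M HM] := choice bnd.
exists (\big[Num.max/0]_i M i); first exact: bigmax_ge_id.
move=> i s s0 st; apply: (le_trans (HM i s s0 st)).
exact: (le_bigmax_cond _ M).
Qed.

Let velocity i s := \sum_j a i j s * (y j s - y i s).

Let measurable_diff i j (D : set R) : measurable D ->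
  measurable_fun (D : set (lebesgue_type R)) (fun s => y j s - y i s).
Proof.
move=> mD; apply: measurable_fun_completed => //.
apply: measurable_funTS; apply: continuous_measurable_fun => s.
by apply: cvgB; exact: trajectory_continuous.
Qed.

Let integrable_velocity i : locally_integrable_pos (velocity i).
Proof.
move=> t t0; have [M M0 HM] := trajectory_bounded t.
have mt := @measurable_completed_itv R `[0, t].
apply: (integrable_Rsum xpredT mt).
apply: (integrable_weighted mt (fun j => @inta i j t t0) (B := 2 * M)).
  by move=> j; apply: measurable_diff; exact: measurable_itv.
move=> j s /=; rewrite in_itv /= => /andP[s0 st].
apply: (le_trans (ler_normB _ _)).
by have := HM i s s0 st; have := HM j s s0 st; lra.
Qed.

Lemma trajectory_increment i u v : 0 <= u -> u <= v ->
  y i v - y i u = \int[mu]_(s in `]u, v]) velocity i s.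
Proof.
move=> u0 uv; rewrite (Rintegral_oc (integrable_velocity i)) //.
have yE t : 0 <= t -> y i t = x i 0 + primitive (velocity i) t.
  move=> t0; rewrite /= max_r // (hx.2 i t t0); congr (_ + _).
  apply: eq_Rintegral => s; rewrite inE /= in_itv /= => /andP[s0 _].
  by rewrite /velocity; apply: eq_bigr => j _; rewrite /= max_r.
by rewrite !yE ?(le_trans u0) //; lra.
Qed.

Let weight_increment i j u v : 0 <= u -> u <= v ->
  \int[mu]_(s in `]u, v]) a i j s = A i j v - A i j u.
Proof. by move=> u0 uv; exact: Rintegral_oc. Qed.

Let integrable_oc i j u v : 0 <= u -> mu.-integrable `]u, v] (EFin \o a i j).
Proof.
move=> u0; apply: (@integrable_sub_pos _ _ (@inta i j) _ u v) => //.
exact: subset_itv_oc_cc.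
Qed.

(** The weights into [i] are part of the total weight, which serves as a common clock for all
    agents. *)
Let weighted_le i (c : 'I_m.+1 -> R -> R) B u v : 0 <= B -> 0 <= u -> u <= v ->
  (forall j, measurable_fun (`]u, v]%classic : set (lebesgue_type R)) (c j)) ->
  (forall j s, u < s -> s <= v -> `|c j s| <= B) ->
  `|\int[mu]_(s in `]u, v]) (\sum_j a i j s * c j s)| <=
  B * (total_weight A v - total_weight A u).
Proof.
move=> B0 u0 uv mc cB.
have mo := @measurable_completed_itv R `]u, v].
apply: (le_trans (normr_Rintegral_weighted (B := B) mo _ mc _ _)).
- by move=> j; exact: integrable_oc.
- by move=> j s /=; rewrite in_itv /= => /andP[us _]; apply: a0; lra.
- by move=> j s /=; rewrite in_itv /= => /andP[us sv]; exact: cB.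
apply: ler_wpM2l => //; rewrite /total_weight -sumrB [in leRHS](bigD1 i) //=.
rewrite -[leLHS]addr0 lerD //.
  rewrite -sumrB; apply: ler_sum => j _; by rewrite weight_increment.
apply: sumr_ge0 => k _; rewrite -sumrB; apply: sumr_ge0 => j _.
by rewrite subr_ge0; apply: primitive_mono uv => // t; exact: a0.
Qed.

(** On []u, v]] each position moves by at most [2 * M * D], so freezing changes a difference of
    positions by at most [4 * M * D]; integration against the weights brings the second factor [D].
    Balance is the pointwise inequality integrated. *)
Lemma flow_of_trajectory (T K : R) : 1 <= K ->
  (sup_reciprocity_ratio a T <= K%:E)%E -> flow A y K T.
Proof.
move=> K1 supK; split => //.
- by move=> i j; exact: primitive_continuous.
- by move=> i j u v; apply: primitive_mono => // t; exact: a0.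
- exact: trajectory_continuous.
- have [M M0 HM] := trajectory_bounded T.
  have tot_mono u v : u <= v -> total_weight A u <= total_weight A v.
    move=> uv; apply: ler_sum => i _; apply: ler_sum => j _.
    by apply: primitive_mono uv => // t; exact: a0.
  have osc i u v : 0 <= u -> u <= v -> v <= T ->
      `|y i v - y i u| <= 2 * M * (total_weight A v - total_weight A u).
    move=> u0 uv vT; rewrite trajectory_increment //.
    apply: (@weighted_le i (fun j s => y j s - y i s) (2 * M) u v _ u0 uv) =>
      [|j|j s us sv]; first exact: mulr_ge0.
      by apply: measurable_diff; exact: measurable_itv.
    have s0 : 0 <= s by lra.
    have sT := le_trans sv vT.
    apply: (le_trans (ler_normB _ _)).
    by have := HM i s s0 sT; have := HM j s s0 sT; lra.
  exists (4 * M); first by rewrite mulr_ge0.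
  move=> i u v u0 uv vT; set D := total_weight A v - total_weight A u.
  have D0 : 0 <= D by rewrite subr_ge0 tot_mono.
  have mo := @measurable_completed_itv R `]u, v].
  rewrite trajectory_increment //.
  have -> : \sum_j (A i j v - A i j u) * (y j v - y i v) =
      \int[mu]_(s in `]u, v]) \sum_j a i j s * (y j v - y i v).
    rewrite (Rintegral_sum xpredT mo) => [|j].
      apply: eq_bigr => j _.
      by rewrite (RintegralZr _ mo (@integrable_oc i j u v u0)) weight_increment.
    exact: (integrable_mulr _ mo (@integrable_oc i j u v u0)).
  rewrite -RintegralB //; last 2 first.
  - apply: (@integrable_sub_pos _ _ (integrable_velocity i) _ u v) => //.
    exact: subset_itv_oc_cc.
  - apply: (integrable_Rsum xpredT mo) => j.
    exact: (integrable_mulr _ mo (@integrable_oc i j u v u0)).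
  have -> : \int[mu]_(s in `]u, v])
      (velocity i s - \sum_j a i j s * (y j v - y i v)) =
      \int[mu]_(s in `]u, v]) (\sum_j a i j s *
        ((y j s - y i s) - (y j v - y i v))).
    apply: eq_Rintegral => s _; rewrite /velocity -sumrB.
    by apply: eq_bigr => j _; rewrite -mulrBr.
  rewrite (_ : 4 * M * D ^+ 2 = (4 * M * D) * D); last by ring.
  apply: (@weighted_le i (fun j s => (y j s - y i s) - (y j v - y i v))
    (4 * M * D) u v _ u0 uv) => [|j|j s us sv]; first by rewrite !mulr_ge0.
    apply: measurable_funB; last exact: measurable_cst.
    by apply: measurable_diff; exact: measurable_itv.
  have s0 : 0 <= s by lra.
  have oscD k : `|y k v - y k s| <= 2 * M * D.
    apply: (le_trans (osc k s v s0 sv vT)); apply: ler_wpM2l; first by rewrite mulr_ge0.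
    by rewrite lerD2l lerN2 tot_mono // ltW.
  rewrite (_ : _ - _ = - (y j v - y j s) + (y i v - y i s)); last by ring.
  apply: (le_trans (ler_normD _ _)); rewrite normrN.
  by have := oscD i; have := oscD j; lra.
- move=> S u v SP u0 uv vT.
  have mo := @measurable_completed_itv R `]u, v].
  have int2 (f : 'I_m.+1 -> 'I_m.+1 -> R -> R) :
      (forall i j, mu.-integrable `]u, v] (EFin \o f i j)) ->
      mu.-integrable `]u, v] (EFin \o (fun s => \sum_(i in S) \sum_(j in ~: S) f i j s))
      /\ \int[mu]_(s in `]u, v]) (\sum_(i in S) \sum_(j in ~: S) f i j s) =
         \sum_(i in S) \sum_(j in ~: S) \int[mu]_(s in `]u, v]) f i j s.
    move=> intf.
    have int1 i : mu.-integrable `]u, v] (EFin \o (fun s => \sum_(j in ~: S) f i j s)).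
      exact: integrable_Rsum.
    split; first exact: integrable_Rsum.
    by rewrite Rintegral_sum //; apply: eq_bigr => i _; rewrite Rintegral_sum.
  have [i1 e1] := int2 (fun i j => a j i) (fun i j => @integrable_oc j i u v u0).
  have [i2 e2] := int2 a (fun i j => @integrable_oc i j u v u0).
  have -> : outflow A S u v =
      \int[mu]_(s in `]u, v]) (\sum_(i in S) \sum_(j in ~: S) a j i s).
    by rewrite e1; apply: eq_bigr => i _; apply: eq_bigr => j _; rewrite weight_increment.
  have -> : inflow A S u v =
      \int[mu]_(s in `]u, v]) (\sum_(i in S) \sum_(j in ~: S) a i j s).
    by rewrite e2; apply: eq_bigr => i _; apply: eq_bigr => j _; rewrite weight_increment.
  have i3 : mu.-integrable `]u, v]
      (EFin \o (fun s => K * \sum_(i in S) \sum_(j in ~: S) a i j s)).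
    exact: (integrable_mull K mo i2).
  rewrite -(RintegralZl _ mo i2); apply: (le_Rintegral mo i1 i3).
  move=> s /=; rewrite in_itv /= => /andP[us sv].
  apply: reciprocity_ratio_balanced supK => //; lra.
Qed.

End flow_of_trajectory.

(** * The time sequence *)

Section times.
Variables (R : realType) (m : nat) (a : 'I_m.+1 -> 'I_m.+1 -> R -> R).
Hypotheses (ha : admissible_weights a) (hconn : persistent_connectivity a).
Hypothesis m0 : (0 < m)%N.
Local Notation mu := (@completed_lebesgue_measure R).
Local Notation A := (fun i j => primitive (a i j)).

Let a0 i j t : 0 <= t -> 0 <= a i j t.
Proof. by have [h _ _] := ha i j; exact: h. Qed.

Let inta i j : locally_integrable_pos (a i j).
Proof. by have [_ _ h] := ha i j; exact: h. Qed.

Let A_mono i j u v : u <= v -> A i j u <= A i j v.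
Proof. by apply: primitive_mono => // t; exact: a0. Qed.

Lemma connect_crossing (T : finType) (e : rel T) (S : {set T}) i j :
  connect e j i -> j \notin S -> i \in S ->
  exists p q, [/\ p \notin S, q \in S & e p q].
Proof.
move=> /connectP[s]; elim: s j => [|k s IH] j /=; first by move=> _ -> /negP.
move=> /andP[ejk ks] il jS iS; have [kS|kS] := boolP (k \in S).
  by exists j, k.
exact: (IH k).
Qed.

(** Strong connectivity makes some persistent edge enter [S], and the integral along this edge alone
    diverges. *)
Lemma cut_weight_unbounded (S : {set 'I_m.+1}) (u : R) : nonempty_proper S ->
  exists2 t, u <= t & 1 <= inflow A S u t.
Proof.
rewrite /nonempty_proper finset.properT => /andP[/finset.set0Pn[i iS]].
rewrite -finset.subTset => /fintype.subsetPn[j _ jS].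
have ji : j != i by apply: contraNneq jS => ->.
have [p [q [pS qS /eqP epq]]] := connect_crossing (hconn ji) jS iS.
have [t t0 At] := primitive_unbounded (@inta q p) (@a0 q p) (1 + A q p u) epq.
exists (Num.max u t); first by rewrite le_max lexx.
have Au : A q p t <= A q p (Num.max u t) by apply: A_mono; rewrite le_max lexx orbT.
have ut : u <= Num.max u t by rewrite le_max lexx.
rewrite /inflow (bigD1 q) //= (bigD1 p) ?inE //=.
have h1 : 0 <= \sum_(j0 in ~: S | j0 != p) (A q j0 (Num.max u t) - A q j0 u).
  by apply: sumr_ge0 => k _; rewrite subr_ge0; exact: A_mono.
have h2 : 0 <= \sum_(i0 in S | i0 != q) \sum_(j0 in ~: S)
    (A i0 j0 (Num.max u t) - A i0 j0 u).
  apply: sumr_ge0 => l _; apply: sumr_ge0 => k _.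
  by rewrite subr_ge0; exact: A_mono.
move: At Au h1 h2; lra.
Qed.

Lemma min_cut_weightE u t : 0 <= u -> u <= t ->
  min_cut_weight a u t =
  \big[mine/+oo%E]_(S : {set 'I_m.+1} | nonempty_proper S) (inflow A S u t)%:E.
Proof.
move=> u0 ut; apply: eq_bigr => S _; rewrite /inflow -sumEFin.
apply: eq_bigr => i _; rewrite -sumEFin; apply: eq_bigr => j _.
by rewrite integral_cc.
Qed.

(** The minimal cut weight is continuous, vanishes at [u] and later reaches 1, so its first hitting
    time of 1 is the least element sought and the junk value of [least] does not arise. *)
Lemma next_time_spec u : 0 <= u -> u <= next_time a u /\
  forall S, nonempty_proper S -> 1 <= inflow A S u (next_time a u).
Proof.
move=> u0.
(* The default 2 replaces [+oo] to keep [f] real-valued; being above 1, it does not affect the level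
   1. *)
pose f t := \big[Num.min/2]_(S : {set 'I_m.+1} | nonempty_proper S) inflow A S u t.
have cf : continuous f.
  apply: continuous_big => [|S _]; first exact: min_continuous.
  apply: continuous_big => [|i _]; first exact: add_continuous.
  apply: continuous_big => [|j _]; first exact: add_continuous.
  move=> t; apply: cvgB; last exact: cvg_cst.
  exact: (primitive_continuous (@inta i j)).
have cut_lt1 t : u <= t -> f t < 1 -> (min_cut_weight a u t < 1%E)%E.
  move=> ut; rewrite min_cut_weightE // => /bigmin_ltP[h|[S SP fS]]; first by exfalso; lra.
  by apply/bigmin_ltP; right; exists S; rewrite ?lte_fin.
have cut_eq1 t : u <= t -> f t = 1 -> min_cut_weight a u t = 1%E.
  move=> ut ft; rewrite min_cut_weightE //; apply/eqP; rewrite eq_le; apply/andP; split.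
    have /bigmin_leP[h|[S SP fS]] : f t <= 1 by rewrite ft.
      by exfalso; lra.
    by apply/bigmin_leP; right; exists S; rewrite ?lee_fin.
  apply: le_bigmin => [|S SP]; first exact: leey.
  by rewrite lee_fin -ft; exact: (bigmin_le_cond _ (fun S => inflow A S u t)).
have fu : f u <= 1.
  have SP : nonempty_proper [set ord0 : 'I_m.+1]%SET by exact: nonempty_proper1.
  apply: (@le_trans _ _ (inflow A [set ord0]%SET u u)).
    exact: (bigmin_le_cond _ (fun S => inflow A S u u)).
  rewrite /inflow big1 // => i _; rewrite big1 // => j _; exact: subrr.
have [v uv fv] : exists2 v, u <= v & 1 <= f v.
  have hit S : exists t, u <= t /\ (nonempty_proper S -> 1 <= inflow A S u t).
    have [SP|SP] := boolP (nonempty_proper S); last by exists u.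
    by have [t ut tS] := cut_weight_unbounded u SP; exists t.
  have [g Hg] := choice hit.
  exists (\big[Num.max/u]_S g S); first exact: bigmax_ge_id.
  apply: le_bigmin => [|S SP]; first by lra.
  have [_ /(_ SP) h] := Hg S; apply: (le_trans h).
  apply: ler_sum => i _; apply: ler_sum => j _; rewrite lerD2r.
  by apply: A_mono; exact: (le_bigmax_cond _ g).
have [t /andP[ut tv] [ft below]] := first_hitting uv cf fu fv.
have nextt : next_time a u = t.
  rewrite /next_time /least; apply: xget_unique.
    split; first by split => //; exact: cut_eq1.
    move=> r [ur cutr]; rewrite leNgt; apply/negP => rt.
    have := cut_lt1 r ur (below r ur rt); rewrite cutr.
    by rewrite ltxx.
  move=> r [[ur cutr] lbr]; apply/eqP; rewrite eq_le; apply/andP; split.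
    by apply: lbr; split => //; exact: cut_eq1.
  rewrite leNgt; apply/negP => rt.
  by have := cut_lt1 r ur (below r ur rt); rewrite cutr ltxx.
rewrite nextt; split => // S SP; rewrite -ft.
exact: (bigmin_le_cond _ (fun S => inflow A S u t)).
Qed.

Lemma iter_next_time_ge0 u q : 0 <= u -> 0 <= iter q (next_time a) u.
Proof.
move=> u0; elim: q => //= q IH.
by have [h _] := next_time_spec IH; exact: le_trans h.
Qed.

Lemma time_seq_ge0 p : 0 <= time_seq a p.
Proof. by elim: p => //= p IH; exact: iter_next_time_ge0. Qed.

End times.

(** * Consensus *)

Lemma nneseries_pinfty_unbounded (R : realType) (r : nat -> R) (B : R) :
  (forall p, 0 <= r p) -> (\sum_(0 <= p <oo) (r p)%:E = +oo)%E ->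
  exists N, B < \sum_(0 <= p < N) r p.
Proof.
move=> r0 roo; apply: contrapT => nob.
suff : (\sum_(0 <= p <oo) (r p)%:E <= B%:E)%E by rewrite roo leye_eq.
apply: lime_le; first by apply: is_cvg_nneseries => p _ _; rewrite lee_fin.
apply: nearW => N; rewrite sumEFin lee_fin leNgt; apply/negP => h.
by apply: nob; exists N.
Qed.

Section consensus.
Variables (R : realType) (m : nat) (a : 'I_m.+1 -> 'I_m.+1 -> R -> R)
  (x : 'I_m.+1 -> R -> R).
Hypotheses (m0 : (0 < m)%N) (ha : admissible_weights a)
  (hconn : persistent_connectivity a) (hslow : slow_divergence a)
  (hx : trajectory a x).

Let A i j := primitive (a i j).
Let y i := x i \o Num.max 0.
Let K t := fine (sup_reciprocity_ratio a t).
Let h := m.+1./2.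

Let a0 i j t : 0 <= t -> 0 <= a i j t.
Proof. by have [H _ _] := ha i j; exact: H. Qed.

Let KE t : 0 <= t -> (K t)%:E = sup_reciprocity_ratio a t.
Proof. by move=> t0; rewrite fineK //; exact: hslow.1. Qed.

Let K1 t : 0 <= t -> 1 <= K t.
Proof. by move=> t0; rewrite -lee_fin KE //; exact: sup_reciprocity_ratio_ge1. Qed.

Let flowK t : 0 <= t -> flow A y (K t) t.
Proof. by move=> t0; apply: flow_of_trajectory; rewrite ?K1 ?KE. Qed.

Let hi t := \big[Num.max/y ord0 t]_i y i t.
Let lo t := \big[Num.min/y ord0 t]_i y i t.

Let y_hi i t : y i t <= hi t.
Proof. exact: (le_bigmax_cond _ (fun i => y i t)). Qed.

Let lo_y i t : lo t <= y i t.
Proof. exact: (bigmin_le_cond _ (fun i => y i t)). Qed.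

Let hi_le b t : (forall i, y i t <= b) -> hi t <= b.
Proof. by move=> yb; apply: bigmax_le. Qed.

Let le_lo b t : (forall i, b <= y i t) -> b <= lo t.
Proof. by move=> yb; apply: le_bigmin. Qed.

Let hi_mono u v : 0 <= u -> u <= v -> hi v <= hi u.
Proof.
move=> u0 uv; apply: hi_le => i.
by apply: (upper_bound_preserved (flowK (le_trans u0 uv)) u0 uv (lexx v)).
Qed.

Let lo_mono u v : 0 <= u -> u <= v -> lo u <= lo v.
Proof.
move=> u0 uv; apply: le_lo => i; rewrite -lerN2.
apply: (upper_bound_preserved (flowN (flowK (le_trans u0 uv))) u0 uv (lexx v)) => j.
by rewrite lerN2.
Qed.

Let t_ p := time_seq a p.

Let t_ge0 p : 0 <= t_ p.
Proof. exact: time_seq_ge0. Qed.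

Let tau p q := iter q (next_time a) (t_ p).

Let tau_ge0 p q : 0 <= tau p q.
Proof. exact: iter_next_time_ge0. Qed.

Let c : R := ((16 * m.+1%:R)^-1) ^+ h / 2.

(** [K] is taken at the end [t_ p.+1] of the round, where it bounds the ratios at all earlier
    times. *)
Lemma spread_contracts p : hi (t_ p.+1) - lo (t_ p.+1) <=
  (hi (t_ p) - lo (t_ p)) * (1 - c * K (t_ p.+1) ^- h).
Proof.
have [a1 [b1 [yab ab]]] := diameter_shrinks (a0 := lo (t_ p)) (b0 := hi (t_ p))
  (tau := tau p) (flowK (t_ge0 p.+1)) m0 (tau_ge0 p 0)
  (fun q _ => (next_time_spec ha hconn m0 (tau_ge0 p q)).1) (lexx _)
  (fun i => introT andP (conj (lo_y i (t_ p)) (y_hi i (t_ p))))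
  (fun q S _ => (next_time_spec ha hconn m0 (tau_ge0 p q)).2 S).
have hb : hi (t_ p.+1) <= b1 by apply: hi_le => i; case/andP: (yab i).
have al : a1 <= lo (t_ p.+1) by apply: le_lo => i; case/andP: (yab i).
apply: (le_trans (lerB hb al)); apply: (le_trans ab).
rewrite (_ : shrink_factor m (K (t_ p.+1)) ^+ m.+1./2 / 2 = c * K (t_ p.+1) ^- h) //.
by rewrite /c /shrink_factor -/h exprMn (exprVn (K _)) mulrAC.
Qed.

(** If the spread never fell below [e], round [p] would lower it by at least [c * r p.+1 * e], and
    these amounts have a divergent sum. *)
Lemma spread_vanishes e : 0 < e -> exists p, hi (t_ p) - lo (t_ p) < e.
Proof.
move=> e0; apply: contrapT => nop.
have c0 : 0 < c by rewrite divr_gt0 // exprn_gt0 // invr_gt0 mulr_gt0.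
have D_ge p : e <= hi (t_ p) - lo (t_ p).
  by rewrite leNgt; apply/negP => he; apply: nop; exists p.
pose r p := K (t_ p) ^- h.
have r0 p : 0 <= r p.
  by rewrite invr_ge0 exprn_ge0 //; apply: le_trans (K1 (t_ge0 p)).
have step p : hi (t_ p.+1) - lo (t_ p.+1) + c * r p.+1 * e <= hi (t_ p) - lo (t_ p).
  have := spread_contracts p; rewrite -/(r p.+1).
  have : c * r p.+1 * e <= c * r p.+1 * (hi (t_ p) - lo (t_ p)).
    by apply: ler_wpM2l => //; rewrite mulr_ge0 // ltW.
  lra.
have sums N : hi (t_ N) - lo (t_ N) + c * e * (\sum_(0 <= p < N) r p.+1) <=
    hi (t_ 0) - lo (t_ 0).
  elim: N => [|N IH]; first by rewrite big_geq // mulr0 addr0.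
  by rewrite big_nat_recr //=; have := step N; lra.
(* The contraction involves [r p.+1] only, so the term [r 0] of the series is set aside in the
   bound. *)
have [N] := nneseries_pinfty_unbounded
  (r 0 + (hi (t_ 0) - lo (t_ 0)) / (c * e)) r0 hslow.2.
case: N => [|N].
  rewrite big_geq // ltNge addr_ge0 // divr_ge0 ?mulr_ge0 ?(ltW c0) ?(ltW e0) //.
  exact: le_trans (ltW e0) (D_ge 0).
rewrite big_nat_recl // ltrD2l ltr_pdivrMr ?mulr_gt0 // mulrC => hN.
by have := sums N; have := D_ge N; move: hN; lra.
Qed.

(** The intervals from [lo] to [hi] are nested and their widths at the times [t_ p] become
    arbitrarily small; [l] lies in all of these. *)
Lemma common_limit : exists l : R, forall i, x i t @[t --> +oo] --> l.
Proof.
pose l := sup (range (fun p => lo (t_ p))).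
have lo_hi p q : lo (t_ p) <= hi (t_ q).
  have [pq|/ltW qp] := leP (t_ p) (t_ q).
    apply: (le_trans (lo_mono (t_ge0 p) pq)).
    exact: le_trans (lo_y ord0 _) (y_hi ord0 _).
  apply: le_trans (hi_mono (t_ge0 q) qp).
  exact: le_trans (lo_y ord0 _) (y_hi ord0 _).
have lo_l p : lo (t_ p) <= l.
  apply: ub_le_sup; last by exists p.
  by exists (hi (t_ 0)) => _ [q _ <-].
have l_hi p : l <= hi (t_ p).
  apply: ge_sup; first by exists (lo (t_ 0)); exists 0%N.
  by move=> _ [q _ <-].
exists l => i; apply/cvgrPdist_lt => e e0.
have [p Dp] := spread_vanishes e0.
exists (t_ p); split; first exact: num_real.
move=> t /= /ltW pt.
have t0 : 0 <= t := le_trans (t_ge0 p) pt.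
have yt : y i t = x i t by rewrite /y /= max_r.
have := hi_mono (t_ge0 p) pt; have := lo_mono (t_ge0 p) pt.
have := lo_y i t; have := y_hi i t; rewrite yt ltr_norml.
by have := lo_l p; have := l_hi p; lra.
Qed.

End consensus.

Theorem theorem3 (R : realType) (n : nat) (a : 'I_n -> 'I_n -> R -> R)
    (hn : (2 <= n)%N) (ha : admissible_weights a)
    (hconn : persistent_connectivity a) (hslow : slow_divergence a)
    (x : 'I_n -> R -> R) (hx : trajectory a x) :
  reaches_consensus x.
Proof.
case: n => [|m] in a hn ha hconn hslow x hx *; first by [].
have [l xl] := common_limit hn ha hconn hslow hx.
split=> [i|i j]; first by apply/cvg_ex; exists l; exact: xl.
by rewrite (cvg_lim _ (xl i)) // (cvg_lim _ (xl j)).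
Qed.
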